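(* Let $1<p<\infty$, let $k\ge 1$ be an integer, and let $T$ be either a non-degenerate $\omega$-Calderón–Zygmund operator or a non-degenerate homogeneous Calderón–Zygmund operator on $\mathbb{R}^n$. Then there is a constant $C>0$, independent of $b$, such that for every complex-valued function $b\in L^k_{\mathrm{loc}}(\mathbb{R}^n)$, $$\|b\|_{\mathrm{BMO}}^k\le C\,\|C_b^k(T)\|_{L^p\to L^p}.$$
   Context: All functions and kernels may be complex-valued; cubes are cubes in $\mathbb{R}^n$ and $b_Q=\frac1{|Q|}\int_Q b$. The BMO norm is $\|b\|_{\mathrm{BMO}}=\sup_Q \frac1{|Q|}\int_Q|b-b_Q|$, the supremum over all cubes $Q\subset\mathbb{R}^n$. Commutators: formally $[b,T]f=bTf-T(bf)$, $C_b^1(T)=[b,T]$ and $C_b^k(T)=[b,C_b^{k-1}(T)]$. $T$ is a linear operator associated with a kernel $K$, in the sense that $Tf(x)=\int K(x,y)f(y)\,dy$ for a.e. $x\notin\operatorname{supp} f$; correspondingly, for bounded compactly supported $f$ and a.e. $x\notin \operatorname{supp} f$, $$C_b^k(T)f(x)=\int_{\mathbb{R}^n}(b(x)-b(y))^kK(x,y)f(y)\,dy.$$ $\|C_b^k(T)\|_{L^p\to L^p}\in[0,\infty]$ is the least constant $N$ with $\|C_b^k(T)f\|_{L^p}\le N\|f\|_{L^p}$ for all bounded compactly supported $f$. $\omega$-Calderón–Zygmund kernel: a function $K(x,y)$, $x\ne y$, with $|K(x,y)|\le \frac{C_K}{|x-y|^n}$ for all $x\neq y$ and $$|K(x,y)-K(x',y)|+|K(y,x)-K(y,x')|\le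 \frac1{|x-y|^n}\,\omega\Big(\frac{|x-x'|}{|x-y|}\Big)\quad\text{whenever } |x-x'|<|x-y|/2,$$ where $\omega:[0,1)\to[0,\infty)$ is increasing. Homogeneous Calderón–Zygmund kernel: $K(x,y)=|x-y|^{-n}\,\Omega\big(\frac{x-y}{|x-y|}\big)$ with $\Omega\in L^1(\mathbb{S}^{n-1})$. $T$ is a non-degenerate $\omega$-Calderón–Zygmund operator if its kernel $K$ is an $\omega$-Calderón–Zygmund kernel with $\omega(t)\to0$ as $t\to0$ and there exists $c_0>0$ such that for every $y\in\mathbb{R}^n$ and $r>0$ there exists $x\in B(y,r)^c$ with $|K(x,y)|\ge \frac1{c_0r^n}$. $T$ is a non-degenerate homogeneous Calderón–Zygmund operator if its kernel is a homogeneous Calderón–Zygmund kernel with $\Omega\in L^1(\mathbb{S}^{n-1})$ and there exists a Lebesgue point $\theta_0\in\mathbb{S}^{n-1}$ of $\Omega$ with $\Omega(\theta_0)\neq0$. *)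

(* Defs.v *)
From HB Require Import structures.
From mathcomp Require Import all_boot all_order all_algebra.
From mathcomp Require Import all_classical all_reals all_analysis.
From mathcomp Require Import measurable_realfun.
From mathcomp.real_closed Require Export complex.

Set Implicit Arguments.
Unset Strict Implicit.
Unset Printing Implicit Defensive.

Import Order.TTheory GRing.Theory Num.Theory.
Import numFieldNormedType.Exports.

Local Open Scope classical_set_scope.
Local Open Scope ring_scope.

Definition rV_display : measure_display.
Proof. exact: default_measure_display. Qed.

(* The sigma-algebra on R^n generated by the coordinates, i.e., the Borel sets.
   Below, measurable functions are Borel functions: every Lebesgue measurable
   function has a Borel representative, and all notions involving measurable
   functions are insensitive to the choice of representative. *)
Section rV_measurable.
Context {R : realType} {n : nat}.

Definition rV_coor (i : 'I_n) (x : 'rV[R]_n) : R := x ord0 i.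

Let rV_set0 : g_sigma_preimage rV_coor set0.
Proof. exact: sigma_algebra0. Qed.

Let rV_setC A : g_sigma_preimage rV_coor A -> g_sigma_preimage rV_coor (~` A).
Proof. exact: sigma_algebraC. Qed.

Let rV_bigcup (F : (set 'rV[R]_n)^nat) :
  (forall i, g_sigma_preimage rV_coor (F i)) ->
  g_sigma_preimage rV_coor (\bigcup_i (F i)).
Proof. exact: sigma_algebra_bigcup. Qed.

HB.instance Definition _ := @isMeasurable.Build rV_display
  'rV[R]_n (g_sigma_preimage rV_coor) rV_set0 rV_setC rV_bigcup.

Lemma measurable_coor (i : 'I_n) :
  measurable_fun [set: 'rV[R]_n] (fun x => x ord0 i).
Proof.
move=> _ Y mY; rewrite setTI; apply: sub_sigma_algebra => /=.
rewrite -bigcup_seq/=; exists i => /=; first by rewrite mem_index_enum.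
by exists Y => //; rewrite setTI.
Qed.

Lemma measurable_fun_coorP d (T : measurableType d) (f : T -> 'rV[R]_n) :
  measurable_fun [set: T] f <->
  forall i, measurable_fun [set: T] (fun t => f t ord0 i).
Proof.
split=> [mf i|mf]; first exact: (measurableT_comp (measurable_coor i)).
suff : g_sigma_preimage rV_coor `<=`
    [set A | measurable (f @^-1` A)].
  by move=> sub _ A mA; rewrite setTI; exact: sub.
apply: smallest_sub.
  split => /=; first by rewrite preimage_set0.
    by move=> A mA; rewrite setTD preimage_setC; exact: measurableC.
  by move=> F mF; rewrite preimage_bigcup; exact: bigcup_measurable.
move=> A; rewrite -bigcup_seq => -[i _ [B mB <-]] /=.
by rewrite setTI; have := mf i measurableT B mB; rewrite setTI.
Qed.

End rV_measurable.

Section rV_cons.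
Context {R : realType} {n : nat}.

Definition rV_cons (p : measurableTypeR R * 'rV[R]_n) : 'rV[R]_n.+1 :=
  \row_i if unlift ord0 i is Some j then p.2 ord0 j else p.1.

Definition rV_uncons (v : 'rV[R]_n.+1) : measurableTypeR R * 'rV[R]_n :=
  (v ord0 ord0, \row_j v ord0 (lift ord0 j)).

Lemma rV_consK : cancel rV_cons rV_uncons.
Proof.
move=> [x v]; rewrite /rV_uncons mxE unlift_none; congr pair.
by apply/rowP => j; rewrite !mxE liftK.
Qed.

Lemma measurable_rV_cons : measurable_fun setT rV_cons.
Proof.
apply/measurable_fun_coorP => i; case: (unliftP ord0 i) => [j|] ->.
  apply: (eq_measurable_fun (fun p => rV_coor j p.2)).
    by move=> p _; rewrite mxE liftK.
  exact: (measurableT_comp (measurable_coor j) measurable_snd).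
apply: (eq_measurable_fun fst) => // p _.
by rewrite mxE unlift_none.
Qed.

Lemma measurable_rV_uncons : measurable_fun setT rV_uncons.
Proof.
apply/measurable_fun_pairP; split; first exact: measurable_coor.
apply/measurable_fun_coorP => j.
apply: (eq_measurable_fun (rV_coor (lift ord0 j))).
  by move=> v _; rewrite /= mxE.
exact: measurable_coor.
Qed.

End rV_cons.

Section lebesgue_rV.
Context {R : realType}.

Section step.
Context {n : nat}.
Variable mu : {sigma_finite_measure set 'rV[R]_n -> \bar R}.

Definition lebesgue_rV_step : set 'rV[R]_n.+1 -> \bar R :=
  pushforward (lebesgue_measure \x mu)%E rV_cons.

Let step0 : lebesgue_rV_step set0 = 0%E.
Proof. by rewrite /lebesgue_rV_step /pushforward preimage_set0 measure0. Qed.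

Let step_ge0 A : (0 <= lebesgue_rV_step A)%E.
Proof. exact: (measure_ge0 (lebesgue_measure \x mu)%E). Qed.

Let step_sigma_additive : semi_sigma_additive lebesgue_rV_step.
Proof.
have mK A : measurable A -> measurable (@rV_cons R n @^-1` A).
  by move=> mA; rewrite -[X in measurable X]setTI; exact: measurable_rV_cons.
move=> F mF tF mUF; rewrite /lebesgue_rV_step /pushforward preimage_bigcup.
apply: (@measure_semi_sigma_additive _ _ _ (lebesgue_measure \x mu)%E).
- by move=> k; exact: mK.
- by move=> i j _ _ [q [Fi Fj]]; apply: tF => //; exists (rV_cons q).
- by rewrite -preimage_bigcup; exact: mK.
Qed.

HB.instance Definition _ := isMeasure.Build _ _ _
  lebesgue_rV_step step0 step_ge0 step_sigma_additive.

Let step_sigma_finite : sigma_finite setT lebesgue_rV_step.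
Proof.
have /sigma_finiteP[F [TF ndF Foo]] := @sigma_finiteT _ _ _ (@lebesgue_measure R).
have /sigma_finiteP[G [TG ndG Goo]] := sigma_finiteT mu.
have mE k : measurable (rV_uncons @^-1` (F k `*` G k)).
  rewrite -[X in measurable X]setTI; apply: measurable_rV_uncons => //.
  by apply: measurableX; [have [] := Foo k|have [] := Goo k].
exists (fun k => rV_uncons @^-1` (F k `*` G k)).
  apply/esym; rewrite -subTset => v _.
  have [i _ Fi] : (\bigcup_i F i) (rV_uncons v).1 by rewrite -TF.
  have [j _ Gj] : (\bigcup_i G i) (rV_uncons v).2 by rewrite -TG.
  exists (maxn i j) => //; split.
    by move: Fi; exact/subsetPset/ndF/leq_maxl.
  by move: Gj; exact/subsetPset/ndG/leq_maxr.
move=> k; split; first exact: mE.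
rewrite /lebesgue_rV_step /pushforward -comp_preimage.
rewrite (_ : rV_uncons \o rV_cons = id); last by apply/funext; exact: rV_consK.
have [[mF Fk] [mG Gk]] := (Foo k, Goo k).
by rewrite preimage_id product_measure1E// lte_mul_pinfty// ge0_fin_numE.
Qed.

HB.instance Definition _ := Measure_isSigmaFinite.Build _ _ _
  lebesgue_rV_step step_sigma_finite.

End step.

Fixpoint lebesgue_rV n : {sigma_finite_measure set 'rV[R]_n -> \bar R} :=
  if n is n'.+1 then lebesgue_rV_step (lebesgue_rV n')
  else \d_ (0 : 'rV[R]_0).

End lebesgue_rV.

Lemma lebesgue_rV_box {R : realType} n (a c : 'rV[R]_n) :
  (forall i, a ord0 i <= c ord0 i) ->
  lebesgue_rV n [set x | forall i, a ord0 i <= x ord0 i <= c ord0 i] =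
  (\prod_(i < n) (c ord0 i - a ord0 i))%:E.
Proof.
elim: n a c => [|n IHn] a c ac.
  rewrite big_ord0 /= diracE mem_set//= => -[].
  by case.
rewrite -[LHS]/((lebesgue_measure \x lebesgue_rV n)%E (rV_cons @^-1` _)).
pose a' : 'rV[R]_n := \row_j a ord0 (lift ord0 j).
pose c' : 'rV[R]_n := \row_j c ord0 (lift ord0 j).
pose B : set 'rV[R]_n := [set x | forall i, a' ord0 i <= x ord0 i <= c' ord0 i].
transitivity ((lebesgue_measure \x lebesgue_rV n)%E
    ((`[a ord0 ord0, c ord0 ord0]%classic : set (measurableTypeR R)) `*` B)).
  congr (product_measure1 _ _ _).
  apply/seteqP; split=> [[x v]/= H|[x v]/= [Hx Hv] i].
    split; first by have := H ord0; rewrite mxE unlift_none in_itv.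
    by move=> i; have := H (lift ord0 i); rewrite !mxE liftK.
  rewrite mxE; case: (unliftP ord0 i) => [j|] ->.
    by have := Hv j; rewrite !mxE.
  by move: Hx; rewrite in_itv.
rewrite product_measure1E; first last.
- rewrite [B](_ : _ = \bigcap_(i in [set: 'I_n])
    (rV_coor i @^-1` `[a' ord0 i, c' ord0 i]%classic)); last first.
    apply/seteqP; split=> x /= H i.
      by move=> _; rewrite /= in_itv; exact: H.
    by have := H i I; rewrite /= in_itv.
  apply: fin_bigcap_measurable => // i _.
  by rewrite -[X in measurable X]setTI; exact: measurable_coor.
- exact: measurable_itv.
rewrite IHn; last by move=> i; rewrite !mxE.
rewrite big_ord_recl EFinM; congr (_ * _)%E; last first.
  by congr EFin; apply: eq_bigr => i _; rewrite !mxE.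
apply: etrans; first exact: lebesgue_measure_itv.
rewrite /= lte_fin; have := ac ord0.
rewrite le_eqVlt => /predU1P[->|->]; last by rewrite EFinB.
by rewrite ltxx subrr.
Qed.

Section euclidean.
Context {R : realType} {n : nat}.
Local Notation V := 'rV[R]_n.

(* The library norm on row vectors is the sup norm, hence this definition. *)
Definition enorm (x : V) : R := Num.sqrt (\sum_i x ord0 i ^+ 2).

Definition eball (x : V) (r : R) : set V := [set y | enorm (y - x) < r].

Definition sphere : set V := [set x | enorm x = 1].

Definition normalize (x : V) : V := (enorm x)^-1 *: x.

Lemma measurable_enorm : measurable_fun setT enorm.
Proof.
apply: (measurableT_comp (f := @Num.sqrt R)).
  by apply: continuous_measurable_fun; exact: sqrt_continuous.
apply: measurable_sum => i; apply: measurable_funX; exact: measurable_coor.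
Qed.

Lemma measurable_normalize : measurable_fun setT normalize.
Proof.
apply/measurable_fun_coorP => i.
apply: (eq_measurable_fun (fun x => enorm x `^ (- 1) * rV_coor i x)).
  by move=> x _; rewrite mxE powR_inv1// sqrtr_ge0.
apply: measurable_funM; last exact: measurable_coor.
exact: (measurableT_comp (measurable_powR _) measurable_enorm).
Qed.

Definition cone (A : set V) : set V :=
  [set x | 0 < enorm x < 1 /\ A (normalize x)].

(* By integration in polar coordinates, the surface measure of a subset of the
   unit sphere is n times the volume of the cone over it in the unit ball. *)
Definition surface_measure (A : set V) : \bar R :=
  (n%:R%:E * lebesgue_rV n (cone A))%E.

Let mcone A : measurable A -> measurable (cone A).
Proof.
move=> mA.
rewrite (_ : cone A = enorm @^-1` `]0, 1[%classic `&` normalize @^-1` A).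
  apply: measurableI; rewrite -[X in measurable X]setTI.
    exact: measurable_enorm.
  exact: measurable_normalize.
by apply/seteqP; split=> x /=; rewrite in_itv.
Qed.

Let surface_measure0 : surface_measure set0 = 0%E.
Proof.
rewrite /surface_measure (_ : cone set0 = set0) ?measure0 ?mule0//.
by apply/seteqP; split=> x // -[].
Qed.

Let surface_measure_ge0 A : (0 <= surface_measure A)%E.
Proof. by rewrite /surface_measure mule_ge0// lee_fin. Qed.

Let surface_measure_sigma_additive : semi_sigma_additive surface_measure.
Proof.
move=> F mF tF mUF; rewrite /surface_measure.
rewrite (_ : cone (\bigcup_i F i) = \bigcup_i cone (F i)); last first.
  apply/seteqP; split=> [x [x01 [i _ Fi]]|x [i _ [x01 Fi]]]; first by exists i.
  by split=> //; exists i.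
under eq_fun do rewrite -ge0_sume_distrr//.
apply: cvgeZl => //.
apply: measure_semi_sigma_additive.
- by move=> i; exact: mcone.
- by move=> i j _ _ [x [[_ Fi] [_ Fj]]]; apply: tF => //; exists (normalize x).
- by apply: bigcup_measurable => i _; exact: mcone.
Qed.

HB.instance Definition _ := isMeasure.Build _ _ _ surface_measure
  surface_measure0 surface_measure_ge0 surface_measure_sigma_additive.

End euclidean.

Section complex_functions.
Context {R : realType}.

Definition cmeasurable d (T : measurableType d) (D : set T) (f : T -> R[i]) :=
  measurable_fun D (fun x => complex.Re (f x)) /\
  measurable_fun D (fun x => complex.Im (f x)).

Definition cintegral d (T : measurableType d) (mu : {measure set T -> \bar R})
    (D : set T) (f : T -> R[i]) : R[i] :=
  ((\int[mu]_(x in D) complex.Re (f x)) +i*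
   (\int[mu]_(x in D) complex.Im (f x)))%C.

Definition cabs (z : R[i]) : R := ComplexField.Normc.normc z.

Definition cLnorm d (T : measurableType d) (mu : {measure set T -> \bar R})
    (p : R) (f : T -> R[i]) : \bar R :=
  Lnorm mu p%:E (fun x => (cabs (f x))%:E).

End complex_functions.

Section harmonic_analysis.
Context {R : realType} {n : nat}.
Local Notation V := 'rV[R]_n.
Local Notation C := R[i].
Local Notation mu := (@lebesgue_rV R n).
Local Notation sigma := (@surface_measure R n).

Definition supp (f : V -> C) : set V := closure [set x | f x != 0].

Definition L1c (f : V -> C) : Prop :=
  [/\ cmeasurable setT f, compact (supp f) &
      (\int[mu]_x (cabs (f x))%:E < +oo)%E].

Definition Linftyc (f : V -> C) : Prop :=
  [/\ cmeasurable setT f, compact (supp f) &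
      exists M : R, forall x, cabs (f x) <= M].

Definition Lloc (k : nat) (b : V -> C) : Prop :=
  cmeasurable setT b /\
  forall D : set V, compact D ->
    (\int[mu]_(x in D) (cabs (b x) ^+ k)%:E < +oo)%E.

Definition cube (a : V) (l : R) : set V :=
  [set x | forall i, a ord0 i <= x ord0 i <= a ord0 i + l].

Definition is_cube (Q : set V) : Prop :=
  exists a l, 0 < l /\ Q = cube a l.

Definition average (Q : set V) (b : V -> C) : C :=
  ((fine (mu Q))^-1)%:C%C * cintegral mu Q b.

Definition BMO_norm (b : V -> C) : \bar R :=
  ereal_sup [set ((fine (mu Q))^-1%:E *
    \int[mu]_(x in Q) (cabs (b x - average Q b))%:E)%E | Q in is_cube].

(* Operators are partially defined, since the products formed in a commutator
   with a function [b] may leave the domain of [T]. *)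
Record operator := Operator {
  odom : set (V -> C);
  oact : (V -> C) -> V -> C }.

Definition commutator (b : V -> C) (T : operator) : operator :=
  {| odom := [set f | odom T f /\ odom T (fun x => b x * f x)];
     oact := fun f x =>
       b x * oact T f x - oact T (fun y => b y * f y) x |}.

Definition iter_commutator (k : nat) (b : V -> C) (T : operator) : operator :=
  iter k (commutator b) T.

(* The values of [T] are functions up to almost everywhere equality. *)
Definition linear_operator (T : operator) : Prop :=
  [/\ forall f, Linftyc f -> odom T f,
      forall f, odom T f -> cmeasurable setT (oact T f) &
      forall (a : C) (f g : V -> C), odom T f -> odom T g ->
        let h := fun x => a * f x + g x in
        odom T h /\
        {ae mu, forall x, oact T h x = a * oact T f x + oact T g x}].

(* The integral is absolutely convergent for almost every x outside the support
   of an integrable compactly supported f, for both classes of kernels below;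
   K is never evaluated on the diagonal. *)
Definition associated (T : operator) (K : V -> V -> C) : Prop :=
  forall f, odom T f -> L1c f ->
    {ae mu, forall x, ~ supp f x ->
      oact T f x = cintegral mu setT (fun y => K x y * f y)}.

(* If the operator is not defined on all bounded functions of compact support
   then no constant is admissible and the norm is +oo. *)
Definition op_norm (p : R) (T : operator) : \bar R :=
  ereal_inf [set N%:E | N in [set N : R | 0 <= N /\
    forall f, Linftyc f -> odom T f /\
      (cLnorm mu p (oact T f) <= N%:E * cLnorm mu p f)%E]].

Definition CZ_kernel (omega : R -> R) (K : V -> V -> C) : Prop :=
  [/\ forall t, 0 <= t < 1 -> 0 <= omega t,
      forall s t, 0 <= s -> s <= t -> t < 1 -> omega s <= omega t,
      exists C_K : R, forall x y, x != y ->
        cabs (K x y) <= C_K / enorm (x - y) ^+ n &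
      forall x x' y, enorm (x - x') < enorm (x - y) / 2 ->
        cabs (K x y - K x' y) + cabs (K y x - K y x') <=
        (enorm (x - y) ^+ n)^-1 * omega (enorm (x - x') / enorm (x - y))].

Definition nondegenerate_CZ_operator (T : operator) : Prop :=
  exists (omega : R -> R) (K : V -> V -> C),
  [/\ CZ_kernel omega K,
      omega t @[t --> 0^'+] --> (0 : R),
      associated T K &
      exists c0 : R, 0 < c0 /\ forall (y : V) (r : R), 0 < r ->
        exists x, ~ eball y r x /\ (c0 * r ^+ n)^-1 <= cabs (K x y)].

(* Only the values on the unit sphere of [Omega] matter. *)
Definition sphere_L1 (Omega : V -> C) : Prop :=
  cmeasurable sphere Omega /\
  (\int[sigma]_(t in sphere) (cabs (Omega t))%:E < +oo)%E.

Definition sphere_lebesgue_point (Omega : V -> C) (t0 : V) : Prop :=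
  let cap r := sphere `&` eball t0 r in
  sphere t0 /\
  ((fine (sigma (cap r)))^-1%:E *
   \int[sigma]_(t in cap r) (cabs (Omega t - Omega t0))%:E)%E
    @[r --> 0^'+] --> (0 : \bar R)%E.

Definition homogeneous_kernel (Omega : V -> C) (K : V -> V -> C) : Prop :=
  sphere_L1 Omega /\
  forall x y, x != y ->
    K x y = ((enorm (x - y) ^+ n)^-1)%:C%C * Omega (normalize (x - y)).

Definition nondegenerate_homogeneous_operator (T : operator) : Prop :=
  exists (Omega : V -> C) (K : V -> V -> C),
  [/\ homogeneous_kernel Omega K, associated T K &
      exists t0, sphere_lebesgue_point Omega t0 /\ Omega t0 != 0].

End harmonic_analysis.

Arguments operator : clear implicits.

(* Main.v *)
Require Import Defs.
From mathcomp Require Import all_boot all_order all_algebra.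
From mathcomp Require Import all_classical all_reals all_analysis.
From mathcomp Require Import measurable_realfun ring lra zify.
Import Order.TTheory GRing.Theory Num.Theory.
Import numFieldNormedType.Exports.

(** Write [h x y = (b x - b y) ^+ k]. Tested on a function [f] living on a cube
[Q], the commutator is the integral of [h x y * K x y * f y] in [y], for [x] in
a cube [Q'] disjoint from [Q] ([iter_commutator_kernel]). If [K] were a constant
[K0] on [Q' x Q], boundedness of the commutator on L^p and Hoelder's inequality
would bound the norm of [h], as an operator from L^oo(Q) to L^1(Q'), by
[N * |Q| / |K0|]. By the binomial formula [h] is a sum of [k + 1] products of a
function of [x] and a function of [y]. For kernels of such bounded rank the
operator norm controls the full L^1 norm on [Q' x Q], with a constant that
depends only on [k] ([finite_rank_L1_le_operator_norm]). This replaces the choice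
of level sets of a median, which needs a real-valued [b]. By Jensen's inequality,
the average of [|h|] over [Q' x Q] dominates the [k]-th power of the mean
oscillation of [b] on [Q], up to a constant.

Non-degeneracy provides, for each [Q], a far translate [Q'] on which [K] is nearly
a nonzero constant [K0] of the right size [1 / |Q|] ([almost_constant]). For
Calderon-Zygmund kernels this is immediate from the smoothness estimate
([CZ_almost_constant]). For homogeneous kernels [Q'] lies in the direction of the
Lebesgue point, and [K - K0] is small only after averaging in one of the two
variables ([homogeneous_almost_constant]). The averages over cubes of the kernel
are reduced to averages of [Omega] over spherical caps by dilations
([integral_annulus], [integral_surface_measure]), which rest on the behaviour
of the Lebesgue measure under affine maps ([ge0_integral_affine]).

The error made by replacing [K] by [K0] is the integral of [|h| * |K - K0|].
Comparing [|h|] with powers of [|b x - c|] and [|b y - c|], where [c] is the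
average of [b] on [Q], one variable can be integrated out of [|K - K0|]; the
remaining oscillations are again controlled by the L^1 norm of [h]. So the error
is a small multiple of this L^1 norm, which is finite, and is absorbed
([oscillation_le_operator_norm]). *)

Set Implicit Arguments.
Unset Strict Implicit.
Unset Printing Implicit Defensive.
Local Open Scope classical_set_scope.
Local Open Scope ring_scope.

(** * The modulus of a complex number *)

Section modulus.
Context {R : realType}.
Implicit Types z w : R[i].

Lemma cabsE z : cabs z = Num.sqrt (complex.Re z ^+ 2 + complex.Im z ^+ 2).
Proof. by case: z. Qed.

Lemma cabs_ge0 z : 0 <= cabs z.
Proof. by rewrite cabsE sqrtr_ge0. Qed.

Lemma cabs0 : cabs (0 : R[i]) = 0.
Proof. exact: ComplexField.Normc.normc0. Qed.

Lemma cabs1 : cabs (1 : R[i]) = 1.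
Proof. exact: ComplexField.Normc.normc1. Qed.

Lemma cabs_eq0 z : (cabs z == 0) = (z == 0).
Proof.
apply/eqP/eqP => [|->]; [exact: ComplexField.Normc.eq0_normc | exact: cabs0].
Qed.

Lemma cabsM z w : cabs (z * w) = cabs z * cabs w.
Proof. exact: ComplexField.Normc.normcM. Qed.

Lemma cabsX z k : cabs (z ^+ k) = cabs z ^+ k.
Proof. by elim: k => [|k IH]; rewrite ?expr0 ?cabs1// !exprS cabsM IH. Qed.

Lemma cabsN z : cabs (- z) = cabs z.
Proof. exact: normcN. Qed.

Lemma cabsD z w : cabs (z + w) <= cabs z + cabs w.
Proof. exact: le_normcD. Qed.

Lemma cabsB z w : cabs (z - w) <= cabs z + cabs w.
Proof. by rewrite -(cabsN w) cabsD. Qed.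

Lemma cabs_distC z w : cabs (z - w) = cabs (w - z).
Proof. by rewrite -cabsN opprB. Qed.

Lemma cabs_real (x : R) : cabs x%:C%C = `|x|.
Proof. by rewrite cabsE /= expr0n/= addr0 sqrtr_sqr. Qed.

Lemma cabs_conj z : cabs (z^*)%C = cabs z.
Proof. by case: z => a b; rewrite !cabsE/= sqrrN. Qed.

Lemma mulc_conj z : z * (z^*)%C = (cabs z ^+ 2)%:C%C.
Proof.
rewrite cabsE sqr_sqrtr ?addr_ge0 ?sqr_ge0//; case: z => a b /=.
by apply/eqP; rewrite eq_complex /=; apply/andP; split; apply/eqP; ring.
Qed.

Lemma ReM z w : complex.Re (z * w) =
  complex.Re z * complex.Re w - complex.Im z * complex.Im w.
Proof. by case: z w => ? ? []. Qed.

Lemma ImM z w : complex.Im (z * w) =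
  complex.Re z * complex.Im w + complex.Im z * complex.Re w.
Proof. by case: z w => ? ? []. Qed.

Lemma normr_Re_le z : `|complex.Re z| <= cabs z.
Proof.
rewrite cabsE -sqrtr_sqr ler_wsqrtr// lerDl; exact: sqr_ge0.
Qed.

Lemma normr_Im_le z : `|complex.Im z| <= cabs z.
Proof.
rewrite cabsE -sqrtr_sqr ler_wsqrtr// lerDr; exact: sqr_ge0.
Qed.

Lemma cabs_le_ReIm z : cabs z <= `|complex.Re z| + `|complex.Im z|.
Proof.
have nn : 0 <= `|complex.Re z| + `|complex.Im z| by rewrite addr_ge0.
rewrite cabsE -[leRHS](ger0_norm nn) -sqrtr_sqr ler_wsqrtr// sqrrD.
rewrite !real_normK ?num_real// addrAC lerDl.
by rewrite mulrn_wge0// mulr_ge0.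
Qed.

(** The conjugate phase of [z]; it is [0] at [0]. *)
Definition csgn z : R[i] := ((cabs z)^-1)%:C%C * (z^*)%C.

Lemma mulc_sgn z : z * csgn z = (cabs z)%:C%C.
Proof.
rewrite /csgn mulrCA mulc_conj.
have [->|z0] := eqVneq z 0; first by rewrite cabs0 invr0 mul0r.
by rewrite -rmorphM expr2 mulrA mulVf ?mul1r// cabs_eq0.
Qed.

Lemma cabs_csgn z : cabs (csgn z) <= 1.
Proof.
rewrite /csgn cabsM cabs_real cabs_conj ger0_norm ?invr_ge0 ?cabs_ge0//.
have [->|z0] := eqVneq z 0; first by rewrite cabs0 mulr0.
by rewrite mulVf ?cabs_eq0.
Qed.

Lemma cabsD_expr z w k : cabs (z + w) ^+ k <= 2 ^+ k * (cabs z ^+ k + cabs w ^+ k).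
Proof.
wlog zw : z w / cabs z <= cabs w.
  move=> H; have [|/ltW] := leP (cabs z) (cabs w); first exact: H.
  by move=> /H; rewrite addrC [X in _ * X]addrC.
apply: (@le_trans _ _ (2 ^+ k * cabs w ^+ k)).
  rewrite -exprMn lerXn2r ?nnegrE ?mulr_ge0 ?cabs_ge0//.
  by rewrite (le_trans (cabsD _ _))// mulr_natl mulr2n lerD2r.
by rewrite ler_wpM2l ?exprn_ge0// lerDr exprn_ge0// cabs_ge0.
Qed.

End modulus.

(** * Measurable and integrable complex functions *)

Section complex_measurability.
Context {R : realType} d (T : measurableType d).
Implicit Types f g : T -> R[i].
Local Notation cmeas := (cmeasurable setT).

Lemma cmeasurable_cst (c : R[i]) : cmeas (fun _ : T => c).
Proof. by split; exact: measurable_cst. Qed.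

Lemma cmeasurableD f g : cmeas f -> cmeas g -> cmeas (fun x => f x + g x).
Proof.
move=> [f1 f2] [g1 g2]; split.
  apply: (eq_measurable_fun (fun x => complex.Re (f x) + complex.Re (g x))).
    by move=> x _; case: (f x) (g x) => ? ? [].
  exact: measurable_funD.
apply: (eq_measurable_fun (fun x => complex.Im (f x) + complex.Im (g x))).
  by move=> x _; case: (f x) (g x) => ? ? [].
exact: measurable_funD.
Qed.

Lemma cmeasurableM f g : cmeas f -> cmeas g -> cmeas (fun x => f x * g x).
Proof.
move=> [f1 f2] [g1 g2]; split.
  under eq_fun do rewrite ReM.
  by apply: measurable_funB; exact: measurable_funM.
under eq_fun do rewrite ImM.
by apply: measurable_funD; exact: measurable_funM.
Qed.

Lemma cmeasurableB f g : cmeas f -> cmeas g -> cmeas (fun x => f x - g x).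
Proof.
move=> mf mg; under eq_fun do rewrite -mulN1r.
by apply: cmeasurableD => //; apply: cmeasurableM => //; exact: cmeasurable_cst.
Qed.

Lemma cmeasurableX f k : cmeas f -> cmeas (fun x => f x ^+ k).
Proof.
move=> mf; elim: k => [|k IH].
  by under eq_fun do rewrite expr0; exact: cmeasurable_cst.
by under eq_fun do rewrite exprS; exact: cmeasurableM.
Qed.

Lemma measurable_cabs f : cmeas f -> measurable_fun setT (fun x => cabs (f x)).
Proof.
move=> [f1 f2]; under eq_fun do rewrite cabsE.
apply: (measurableT_comp (f := @Num.sqrt R)).
  by apply: continuous_measurable_fun; exact: sqrt_continuous.
by apply: measurable_funD; exact: measurable_funX.
Qed.

Lemma cmeasurable_real (r : T -> R) : measurable_fun setT r ->
  cmeas (fun x => (r x)%:C%C).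
Proof. by move=> mr; split => //=; exact: measurable_cst. Qed.

Lemma cmeasurable_conj f : cmeas f -> cmeas (fun x => (f x)^*%C).
Proof.
move=> [f1 f2]; split.
  by apply: (eq_measurable_fun (fun x => complex.Re (f x))) => // x _; case: (f x).
apply: (eq_measurable_fun (fun x => - complex.Im (f x))).
  by move=> x _; case: (f x).
exact: measurableT_comp.
Qed.

Lemma cmeasurable_csgn f : cmeas f -> cmeas (fun x => csgn (f x)).
Proof.
move=> mf; rewrite /csgn; apply: cmeasurableM; last exact: cmeasurable_conj.
apply: cmeasurable_real.
apply: (eq_measurable_fun (fun x => cabs (f x) `^ (- 1))).
  by move=> x _; rewrite powR_inv1// cabs_ge0.
exact: (measurableT_comp (measurable_powR _) (measurable_cabs mf)).
Qed.

Lemma cmeasurable_sum (I : Type) (s : seq I) (F : I -> T -> R[i]) :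
  (forall i, cmeas (F i)) -> cmeas (fun x => \sum_(i <- s) F i x).
Proof.
move=> mF; elim: s => [|i s IH].
  by under eq_fun do rewrite big_nil; exact: cmeasurable_cst.
by under eq_fun do rewrite big_cons; exact: cmeasurableD.
Qed.

Lemma cmeasurable_comp d' (T' : measurableType d') (phi : T' -> T) f :
  measurable_fun setT phi -> cmeas f -> cmeasurable setT (fun x => f (phi x)).
Proof.
by move=> mphi [f1 f2]; split; [exact: (measurableT_comp f1)|exact: (measurableT_comp f2)].
Qed.

End complex_measurability.

Section complex_integral.
Context {R : realType} d (T : measurableType d) (mu : {measure set T -> \bar R}).
Implicit Types f g : T -> R[i].

Definition cintegrable f : Prop :=
  cmeasurable setT f /\ (\int[mu]_x (cabs (f x))%:E < +oo)%E.

Lemma cabs_integral_ge0 f : (0 <= \int[mu]_x (cabs (f x))%:E)%E.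
Proof. by apply: integral_ge0 => x _; rewrite lee_fin cabs_ge0. Qed.

Lemma cintegrable_cabs f : cintegrable f ->
  mu.-integrable setT (fun x => (cabs (f x))%:E).
Proof.
move=> [mf fi]; apply/integrableP; split.
  by apply/measurable_EFinP; exact: measurable_cabs.
apply: le_lt_trans fi; rewrite le_eqVlt; apply/orP; left; apply/eqP.
by apply: eq_integral => x _; rewrite gee0_abs// lee_fin cabs_ge0.
Qed.

Lemma cintegrableP f : cintegrable f <->
  (mu.-integrable setT (EFin \o (fun x => complex.Re (f x))) /\
   mu.-integrable setT (EFin \o (fun x => complex.Im (f x)))).
Proof.
split=> [fi|[rf imf]].
  have := cintegrable_cabs fi; case: fi => [[mf1 mf2] _] fi.
  split; apply: le_integrable fi => //=; try exact/measurable_EFinP.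
  - by move=> x _; rewrite !lee_fin [leRHS]ger0_norm ?cabs_ge0 ?normr_Re_le.
  - by move=> x _; rewrite !lee_fin [leRHS]ger0_norm ?cabs_ge0 ?normr_Im_le.
have mr : measurable_fun setT (fun x => complex.Re (f x)).
  exact/measurable_EFinP/(measurable_int _ rf).
have mi : measurable_fun setT (fun x => complex.Im (f x)).
  exact/measurable_EFinP/(measurable_int _ imf).
have mf : cmeasurable setT f by split.
split => //.
have /integrable_abse H1 := rf; have /integrable_abse H2 := imf.
have := integrableD measurableT H1 H2 => /integrableP[_].
apply: le_lt_trans; apply: ge0_le_integral => //=.
- by move=> x _; rewrite lee_fin cabs_ge0.
- by apply/measurable_EFinP; exact: measurable_cabs.
- apply/measurable_EFinP; apply: measurableT_comp => //.
  by apply: measurable_funD; exact: measurableT_comp.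
- move=> x _; rewrite lee_fin [leRHS]ger0_norm ?addr_ge0//.
  exact: cabs_le_ReIm.
Qed.

Lemma le_cintegrable f g : cmeasurable setT f -> cintegrable g ->
  (forall x, cabs (f x) <= cabs (g x)) -> cintegrable f.
Proof.
move=> mf [mg gi] fg; split => //; apply: le_lt_trans gi.
apply: ge0_le_integral => //=.
- by move=> x _; rewrite lee_fin cabs_ge0.
- by apply/measurable_EFinP; exact: measurable_cabs.
- by apply/measurable_EFinP; exact: measurable_cabs.
- by move=> x _; rewrite lee_fin.
Qed.

Lemma cintegrableD f g : cintegrable f -> cintegrable g ->
  cintegrable (fun x => f x + g x).
Proof.
move=> /cintegrableP[f1 f2] /cintegrableP[g1 g2]; apply/cintegrableP; split.
  apply: eq_integrable (integrableD measurableT f1 g1) => //= x _ /=.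
  by case: (f x) (g x) => ? ? [].
apply: eq_integrable (integrableD measurableT f2 g2) => //= x _ /=.
by case: (f x) (g x) => ? ? [].
Qed.

Lemma cintegrableZ (c : R[i]) f : cintegrable f -> cintegrable (fun x => c * f x).
Proof.
move=> [mf fi]; split.
  by apply: cmeasurableM => //; exact: cmeasurable_cst.
under eq_integral do rewrite cabsM EFinM.
rewrite ge0_integralZl//.
- by rewrite lte_mul_pinfty ?lee_fin ?cabs_ge0// ge0_fin_numE ?lee_fin ?cabs_ge0 ?ltry.
- by apply/measurable_EFinP; exact: measurable_cabs.
- by move=> x _; rewrite lee_fin cabs_ge0.
- by rewrite lee_fin cabs_ge0.
Qed.

Lemma cintegrableB f g : cintegrable f -> cintegrable g ->
  cintegrable (fun x => f x - g x).
Proof.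
move=> fi gi; under eq_fun do rewrite -mulN1r.
by apply: cintegrableD => //; exact: cintegrableZ.
Qed.

Lemma cintegrable0 : cintegrable (fun _ => 0).
Proof.
split; first exact: cmeasurable_cst.
by under eq_integral do rewrite cabs0; rewrite integral0 ltry.
Qed.

Lemma cintegrable_sum (I : Type) (s : seq I) (F : I -> T -> R[i]) :
  (forall i, cintegrable (F i)) -> cintegrable (fun x => \sum_(i <- s) F i x).
Proof.
move=> mF; elim: s => [|i s IH].
  by under eq_fun do rewrite big_nil; exact: cintegrable0.
by under eq_fun do rewrite big_cons; exact: cintegrableD.
Qed.

Lemma cintegrableM_bounded (M : R) f g : cintegrable f -> cmeasurable setT g ->
  (forall x, cabs (g x) <= M) -> cintegrable (fun x => f x * g x).
Proof.
move=> fi mg gM; have [x0|T0] := pselect (exists x : T, True); last first.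
  apply: (le_cintegrable (g := f)) => //; last by move=> x; case: T0; exists x.
  by apply: cmeasurableM => //; case: fi.
have M0 : 0 <= M by case: x0 => x _; exact: le_trans (cabs_ge0 _) (gM x).
apply: (le_cintegrable (g := fun x => M%:C%C * f x)).
- by apply: cmeasurableM => //; case: fi.
- exact: cintegrableZ.
- move=> x; rewrite !cabsM cabs_real ger0_norm// mulrC.
  by rewrite ler_wpM2r ?cabs_ge0.
Qed.

Lemma eq_cintegral f g : f =1 g -> cintegral mu setT f = cintegral mu setT g.
Proof. by move=> /funext ->. Qed.

Lemma cintegralD f g : cintegrable f -> cintegrable g ->
  cintegral mu setT (fun x => f x + g x) =
  cintegral mu setT f + cintegral mu setT g.
Proof.
move=> /cintegrableP[f1 f2] /cintegrableP[g1 g2]; rewrite /cintegral.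
rewrite [RHS]/= {2}/GRing.add/=; congr (_ +i* _)%C.
  rewrite -RintegralD//; apply: eq_Rintegral => x _ /=.
  by case: (f x) (g x) => ? ? [].
rewrite -RintegralD//; apply: eq_Rintegral => x _ /=.
by case: (f x) (g x) => ? ? [].
Qed.

Lemma cintegralZ (c : R[i]) f : cintegrable f ->
  cintegral mu setT (fun x => c * f x) = c * cintegral mu setT f.
Proof.
move=> /cintegrableP[f1 f2]; rewrite /cintegral.
have Zi (r : R) (h : T -> R) : mu.-integrable setT (EFin \o h) ->
    mu.-integrable setT (EFin \o (fun x => r * h x)).
  by move=> hi; apply: eq_integrable (integrableZl measurableT r hi).
apply/eqP; rewrite eq_complex ReM ImM /=; apply/andP; split; apply/eqP.
  rewrite -!RintegralZl// -RintegralB//; try exact: Zi.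
  by apply: eq_Rintegral => x _; rewrite ReM.
rewrite -!RintegralZl// -RintegralD//; try exact: Zi.
by apply: eq_Rintegral => x _; rewrite ImM.
Qed.

Lemma cintegralB f g : cintegrable f -> cintegrable g ->
  cintegral mu setT (fun x => f x - g x) =
  cintegral mu setT f - cintegral mu setT g.
Proof.
move=> fi gi; rewrite -(mulN1r (cintegral _ _ g)) -cintegralZ//.
rewrite -cintegralD//; last exact: cintegrableZ.
by apply: eq_cintegral => x; rewrite mulN1r.
Qed.

Lemma cintegral_sum (I : Type) (s : seq I) (F : I -> T -> R[i]) :
  (forall i, cintegrable (F i)) ->
  cintegral mu setT (fun x => \sum_(i <- s) F i x) =
  \sum_(i <- s) cintegral mu setT (F i).
Proof.
move=> Fi; elim: s => [|i s IH].
  rewrite big_nil; under eq_cintegral do rewrite big_nil.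
  by rewrite /cintegral /= !Rintegral_cst// !mul0r.
rewrite big_cons -IH -cintegralD//; last exact: cintegrable_sum.
by apply: eq_cintegral => x; rewrite big_cons.
Qed.

Lemma cintegral_real (r : T -> R) :
  cintegral mu setT (fun x => (r x)%:C%C) = (\int[mu]_x r x)%:C%C.
Proof. by rewrite /cintegral/= Rintegral_cst// mul0r. Qed.

(** Rotating the integral onto the positive axis reduces the triangle inequality
to the one for the real part. *)
Lemma le_cabs_cintegral f : cintegrable f ->
  ((cabs (cintegral mu setT f))%:E <= \int[mu]_x (cabs (f x))%:E)%E.
Proof.
move=> fi; set z := cintegral mu setT f.
have E : (cabs z)%:C%C = cintegral mu setT (fun x => csgn z * f x).
  by rewrite cintegralZ// mulrC mulc_sgn.
have /(congr1 (@complex.Re R))/= -> := E.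
have gi := cintegrableZ (csgn z) fi.
have [f1 _] := (cintegrableP _).1 gi.
have ci := cintegrable_cabs fi.
have cf : (\int[mu]_x (cabs (f x))%:E)%E \is a fin_num by exact: integrable_fin_num.
rewrite -(fineK cf) lee_fin; apply: le_Rintegral => // x _.
apply: le_trans (ler_norm _) _; apply: le_trans (normr_Re_le _) _.
by rewrite cabsM ler_piMl ?cabs_ge0// cabs_csgn.
Qed.

End complex_integral.

(** * Kernels of finite rank *)

Section finite_rank.
Context {R : realType} d1 d2 (T1 : measurableType d1) (T2 : measurableType d2).
Variables (mu1 : {measure set T1 -> \bar R})
          (mu2 : {sigma_finite_measure set T2 -> \bar R}).

Let rank_sum m (u : nat -> T1 -> R[i]) (v : nat -> T2 -> R[i]) x y :=
  \sum_(i < m) u i x * v i y.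

Let cmeasurable_rank_sum m u v :
  (forall i, cintegrable mu1 (u i)) -> (forall i, cintegrable mu2 (v i)) ->
  cmeasurable setT (fun z : T1 * T2 => rank_sum m u v z.1 z.2).
Proof.
move=> ui vi; apply: cmeasurable_sum => i; apply: cmeasurableM.
  by apply: (cmeasurable_comp measurable_fst); case: (ui i).
by apply: (cmeasurable_comp measurable_snd); case: (vi i).
Qed.

Let measurable_rank_norm m u v :
  (forall i, cintegrable mu1 (u i)) -> (forall i, cintegrable mu2 (v i)) ->
  measurable_fun setT (fun x => \int[mu2]_y (cabs (rank_sum m u v x y))%:E)%E.
Proof.
move=> ui vi.
apply: (measurable_fun_fubini_tonelli_F
  (fun z : T1 * T2 => (cabs (rank_sum m u v z.1 z.2))%:E)).
  by apply/measurable_EFinP; apply: measurable_cabs; exact: cmeasurable_rank_sum.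
by move=> z; rewrite lee_fin cabs_ge0.
Qed.

Let cintegral_rank_sum m u v f x : (forall i, cintegrable mu2 (v i)) ->
  cmeasurable setT f -> (forall y, cabs (f y) <= 1) ->
  cintegral mu2 setT (fun y => rank_sum m u v x y * f y) =
  \sum_(i < m) u i x * cintegral mu2 setT (fun y => v i y * f y).
Proof.
move=> vi mf f1.
have vfi i : cintegrable mu2 (fun y => v i y * f y) by exact: cintegrableM_bounded.
rewrite (eq_cintegral _ (g := fun y => \sum_(i < m) u i x * (v i y * f y))).
  rewrite cintegral_sum; last by move=> i; exact: cintegrableZ.
  by apply: eq_bigr => i _; rewrite cintegralZ.
by move=> y; rewrite mulr_suml; apply: eq_bigr => i _; rewrite mulrA.
Qed.

(** On kernels of rank [m], the L^1 norm is controlled by the norm as an operator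
from L^oo to L^1. The induction tests the kernel on the conjugate phase [f1] of
the last factor [v m]: the image of [f1] is then a multiple of the coefficient
[a] of [v m] in the decomposition below, and what remains has rank [m]. When
[v m] vanishes almost everywhere, [beta] is zero and so are the corrections. *)
Lemma finite_rank_L1_le_operator_norm (m : nat)
    (u : nat -> T1 -> R[i]) (v : nat -> T2 -> R[i]) (M : R) :
  (forall i, cintegrable mu1 (u i)) -> (forall i, cintegrable mu2 (v i)) ->
  (forall f, cmeasurable setT f -> (forall y, cabs (f y) <= 1) ->
    (\int[mu1]_x (cabs (cintegral mu2 setT
      (fun y => (\sum_(i < m) u i x * v i y) * f y)))%:E <= M%:E)%E) ->
  (\int[mu1]_x \int[mu2]_y (cabs (\sum_(i < m) u i x * v i y))%:E <=
    ((2 ^+ m - 1) * M)%:E)%E.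
Proof.
elim: m v M => [|m IH] v M ui vi HM.
  under eq_integral do under eq_integral do rewrite big_ord0 cabs0.
  under eq_integral do rewrite integral0.
  by rewrite integral0 expr0 subrr mul0r.
have M0 : 0 <= M.
  rewrite -lee_fin; apply: le_trans (HM (fun _ => 0) _ _).
  - exact: cabs_integral_ge0.
  - exact: cmeasurable_cst.
  - by move=> y; rewrite cabs0.
have [mv _] := vi m.
pose f1 y := csgn (v m y).
have mf1 : cmeasurable setT f1 by exact: cmeasurable_csgn.
have f1le y : cabs (f1 y) <= 1 by exact: cabs_csgn.
pose bt i := cintegral mu2 setT (fun y => v i y * f1 y).
have vmi := cintegrable_cabs (vi m).
have vmfin : (\int[mu2]_y (cabs (v m y))%:E)%E \is a fin_num.
  exact: integrable_fin_num.
pose beta := \int[mu2]_y cabs (v m y).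
have betaE : (\int[mu2]_y (cabs (v m y))%:E)%E = beta%:E by rewrite -(fineK vmfin).
have beta0 : 0 <= beta by rewrite -lee_fin -betaE cabs_integral_ge0.
have btm : bt m = beta%:C%C.
  by rewrite -cintegral_real; apply: eq_cintegral => y; rewrite mulc_sgn.
pose c i := beta^-1%:C%C * bt i.
pose v' i y := v i y - c i * v m y.
pose a x := u m x + \sum_(i < m) c i * u i x.
have v'i i : cintegrable mu2 (v' i).
  by apply: cintegrableB => //; exact: cintegrableZ.
have ai : cintegrable mu1 a.
  by apply: cintegrableD => //; apply: cintegrable_sum => i; exact: cintegrableZ.
have hE x y : rank_sum m.+1 u v x y = rank_sum m u v' x y + a x * v m y.
  rewrite /rank_sum big_ord_recr /= /a mulrDl addrCA -[LHS]addrC; congr (_ + _).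
  rewrite mulr_suml -big_split /=; apply: eq_bigr => i _.
  by rewrite /v'; ring.
have ale : (\int[mu1]_x (cabs (a x) * beta)%:E <= M%:E)%E.
  have [b0|bN0] := eqVneq beta 0.
    by under eq_integral do rewrite b0 mulr0; rewrite integral0 lee_fin.
  apply: le_trans (HM f1 mf1 f1le); rewrite le_eqVlt; apply/orP; left; apply/eqP.
  apply: eq_integral => x _; congr EFin.
  rewrite [in RHS](cintegral_rank_sum _ _ _ vi mf1 f1le) big_ord_recr /= -/(bt m) btm.
  rewrite -[in LHS](ger0_norm beta0) -cabs_real -cabsM; congr cabs.
  rewrite /a mulrDl addrC; congr (_ + _).
  rewrite mulr_suml; apply: eq_bigr => i _; rewrite -/(bt i) /c.
  rewrite mulrAC (mulrAC _ (bt i)) -rmorphM mulVf// rmorph1 mul1r mulrC//.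
have mabeta : measurable_fun setT (fun x => (cabs (a x) * beta)%:E).
  apply/measurable_EFinP; apply: measurable_funM => //.
  by apply: measurable_cabs; case: ai.
have mcint (w : nat -> T2 -> R[i]) k f : (forall i, cintegrable mu2 (w i)) ->
    cmeasurable setT f -> (forall y, cabs (f y) <= 1) ->
    measurable_fun setT (fun x =>
      (cabs (cintegral mu2 setT (fun y => rank_sum k u w x y * f y)))%:E).
  move=> wi mf fle; apply/measurable_EFinP; apply: measurable_cabs.
  rewrite (_ : (fun x => _) = (fun x => \sum_(i < k) u i x *
      cintegral mu2 setT (fun y => w i y * f y))).
    apply: cmeasurable_sum => i; apply: cmeasurableM; last exact: cmeasurable_cst.
    by case: (ui i).
  by apply/funext => x; exact: cintegral_rank_sum.
have IHv' : (\int[mu1]_x \int[mu2]_y (cabs (rank_sum m u v' x y))%:E <=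
    ((2 ^+ m - 1) * (2 * M))%:E)%E.
  apply: IH => // f mf fle; rewrite -/(rank_sum m u v').
  apply: (@le_trans _ _ (\int[mu1]_x
      ((cabs (cintegral mu2 setT (fun y => rank_sum m.+1 u v x y * f y)))%:E +
       (cabs (a x) * beta)%:E))%E); last first.
    rewrite ge0_integralD//.
    - by rewrite mulr_natl mulr2n EFinD leeD//; exact: HM.
    - by move=> x _; rewrite lee_fin cabs_ge0.
    - exact: mcint.
    - by move=> x _; rewrite lee_fin mulr_ge0 ?cabs_ge0.
  apply: ge0_le_integral => //.
  - by move=> x _; rewrite lee_fin cabs_ge0.
  - exact: mcint.
  - by apply: emeasurable_funD => //; exact: mcint.
  move=> x _; rewrite -EFinD lee_fin.
  have vmf : cintegrable mu2 (fun y => v m y * f y) by exact: cintegrableM_bounded.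
  have hfi : cintegrable mu2 (fun y => rank_sum m.+1 u v x y * f y).
    apply: cintegrableM_bounded mf fle.
    by apply: cintegrable_sum => i; exact: cintegrableZ.
  rewrite (eq_cintegral _ (g := fun y =>
      rank_sum m.+1 u v x y * f y - a x * (v m y * f y))); last first.
    by move=> y; rewrite hE mulrDl mulrA addrK.
  rewrite cintegralB//; last exact: cintegrableZ.
  rewrite cintegralZ//; apply: le_trans (cabsB _ _) _.
  rewrite lerD2l cabsM ler_wpM2l ?cabs_ge0//.
  rewrite -lee_fin -betaE; apply: le_trans (le_cabs_cintegral vmf) _.
  have [mvmf _] := vmf.
  apply: ge0_le_integral => //=.
  - by move=> y _; rewrite lee_fin cabs_ge0.
  - by apply/measurable_EFinP; exact: measurable_cabs.
  - by apply/measurable_EFinP; exact: measurable_cabs.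
  - by move=> y _; rewrite lee_fin cabsM ler_piMr ?cabs_ge0.
rewrite -/(rank_sum m.+1 u v).
apply: (@le_trans _ _ (\int[mu1]_x
    (\int[mu2]_y (cabs (rank_sum m u v' x y))%:E + (cabs (a x) * beta)%:E))%E);
    last first.
  rewrite ge0_integralD//.
  - rewrite (_ : (2 ^+ m.+1 - 1) * M = (2 ^+ m - 1) * (2 * M) + M); last first.
      by rewrite exprS; ring.
    by rewrite EFinD leeD.
  - by move=> x _; exact: cabs_integral_ge0.
  - exact: measurable_rank_norm.
  - by move=> x _; rewrite lee_fin mulr_ge0 ?cabs_ge0.
apply: ge0_le_integral => //.
- by move=> x _; exact: cabs_integral_ge0.
- exact: measurable_rank_norm.
- by apply: emeasurable_funD => //; exact: measurable_rank_norm.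
move=> x _; rewrite EFinM -betaE.
have mrs (w : nat -> T2 -> R[i]) k : (forall i, cintegrable mu2 (w i)) ->
    measurable_fun setT (fun y => (cabs (rank_sum k u w x y))%:E).
  move=> wi; apply/measurable_EFinP; apply: measurable_cabs.
  apply: cmeasurable_sum => i; apply: cmeasurableM; first exact: cmeasurable_cst.
  by case: (wi i).
have mvm : measurable_fun setT (fun y => (cabs (v m y))%:E).
  by apply/measurable_EFinP; exact: measurable_cabs.
rewrite -ge0_integralZl//; first last.
- by rewrite lee_fin cabs_ge0.
- by move=> y _; rewrite lee_fin cabs_ge0.
rewrite -ge0_integralD//; first last.
- by apply: measurable_funeM.
- by move=> y _; rewrite -EFinM lee_fin mulr_ge0 ?cabs_ge0.
- exact: mrs.
- by move=> y _; rewrite lee_fin cabs_ge0.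
apply: ge0_le_integral => //.
- by move=> y _; rewrite lee_fin cabs_ge0.
- exact: mrs.
- by apply: emeasurable_funD; [exact: mrs | exact: measurable_funeM].
- move=> y _; rewrite -/(rank_sum m.+1 u v x y) hE -EFinM -EFinD lee_fin -cabsM.
  exact: cabsD.
Qed.

End finite_rank.

(** * Power means *)

Section power_mean.
Context {R : realType} d (T : measurableType d).

(** The graph of [t ^+ k] lies above its tangent line at [a]. *)
Lemma exprn_tangent_le (k : nat) (a t : R) : 0 <= a -> 0 <= t ->
  a ^+ k + k%:R * a ^+ k.-1 * t <= t ^+ k + k%:R * a ^+ k.
Proof.
move=> a0 t0; elim: k => [|[|k] IH]; rewrite ?expr0 ?mulr0n ?mul0r//.
  by rewrite !expr1 !mul1r addrC.
rewrite -subr_ge0 /=; rewrite -subr_ge0 /= in IH.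
have := mulr_ge0 t0 IH.
have : 0 <= k.+1%:R * a ^+ k * (t - a) ^+ 2.
  by rewrite mulr_ge0 ?sqr_ge0// mulr_ge0// exprn_ge0.
rewrite -(natr1 k.+1) !exprS; set N : R := k.+1%:R; set A := a ^+ k.
rewrite !expr0 !mulr1; set B := t ^+ k; lra.
Qed.

Variables (mu : {finite_measure set T -> \bar R}) (m : R).
Hypotheses (m0 : 0 < m) (muT : mu setT = m%:E).

Let integral_cst_mass (c : R) : (\int[mu]_x c%:E = (c * m)%:E)%E.
Proof.
by apply: etrans (integral_cst mu measurableT c%:E) _; rewrite EFinM; congr (_ * _)%E.
Qed.

(** Jensen's inequality for a power, by integrating the tangent line inequality
at the mean value. *)
Lemma power_mean_le (k : nat) (g : T -> R) : (forall x, 0 <= g x) ->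
  mu.-integrable setT (EFin \o g) ->
  ((m * (m^-1 * \int[mu]_x g x) ^+ k)%:E <= \int[mu]_x (g x ^+ k)%:E)%E.
Proof.
move=> g0 gi; set a := m^-1 * _.
have mg : measurable_fun setT g by exact/measurable_EFinP/(measurable_int _ gi).
have fg : (\int[mu]_x (g x)%:E)%E \is a fin_num by exact: integrable_fin_num.
have aE : (\int[mu]_x (g x)%:E)%E = (m * a)%:E.
  by rewrite /a mulrA mulfV ?gt_eqF// mul1r -(fineK fg).
have a0 : 0 <= a.
  by rewrite -(pmulr_rge0 _ m0) -lee_fin -aE integral_ge0// => x _; rewrite lee_fin.
have : (\int[mu]_x (a ^+ k + k%:R * a ^+ k.-1 * g x)%:E <=
        \int[mu]_x (g x ^+ k + k%:R * a ^+ k)%:E)%E.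
  apply: ge0_le_integral => //.
  - by move=> x _; rewrite lee_fin addr_ge0// ?mulr_ge0// exprn_ge0.
  - apply/measurable_EFinP; apply: measurable_funD => //.
    exact: measurable_funM.
  - apply/measurable_EFinP; apply: measurable_funD => //.
    exact: measurable_funX.
  - by move=> x _; rewrite lee_fin exprn_tangent_le.
under eq_integral do rewrite EFinD EFinM.
rewrite ge0_integralD//=; last first.
- apply/measurable_EFinP; exact: measurable_funM.
- by move=> x _; rewrite -EFinM lee_fin mulr_ge0// mulr_ge0// exprn_ge0.
- by move=> x _; rewrite lee_fin exprn_ge0.
rewrite integral_cst_mass ge0_integralZl//; first last.
- by rewrite lee_fin mulr_ge0// exprn_ge0.
- by move=> x _; rewrite lee_fin.
- exact/measurable_EFinP.
under [leRHS]eq_integral do rewrite EFinD.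
rewrite ge0_integralD//=; first last.
- by move=> x _; rewrite lee_fin mulr_ge0// exprn_ge0.
- by apply/measurable_EFinP; exact: measurable_funX.
- by move=> x _; rewrite lee_fin exprn_ge0.
rewrite integral_cst_mass aE -!EFinM.
have -> : k%:R * a ^+ k.-1 * (m * a) = k%:R * a ^+ k * m.
  by case: k => [|k]; rewrite ?mul0r//= exprS; ring.
by rewrite leeD2rE// mulrC.
Qed.

Lemma cintegrable_cst (c : R[i]) : cintegrable mu (fun _ => c).
Proof.
split; first exact: cmeasurable_cst.
by rewrite integral_cst_mass ltry.
Qed.

Lemma cintegrable_pow_le (k j : nat) (b : T -> R[i]) : (j <= k)%N ->
  cmeasurable setT b -> (\int[mu]_x (cabs (b x) ^+ k)%:E < +oo)%E ->
  cintegrable mu (fun x => b x ^+ j).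
Proof.
move=> jk mb bk.
have mbk : measurable_fun setT (fun x => cabs (b x) ^+ k).
  by apply: measurable_funX; exact: measurable_cabs.
split; first exact: cmeasurableX.
apply: (@le_lt_trans _ _ (\int[mu]_x (1 + cabs (b x) ^+ k)%:E)%E).
  apply: ge0_le_integral => //.
  - by move=> x _; rewrite lee_fin cabs_ge0.
  - by apply/measurable_EFinP; apply: measurable_cabs; exact: cmeasurableX.
  - by apply/measurable_EFinP; exact: measurable_funD.
  - move=> x _; rewrite lee_fin cabsX.
    have [b1|/ltW b1] := leP (cabs (b x)) 1.
      by rewrite ler_wpDr ?exprn_ge0 ?cabs_ge0// exprn_ile1// cabs_ge0.
    by rewrite ler_wpDl// ler_weXn2l.
under eq_integral do rewrite EFinD.
rewrite ge0_integralD//=; first last.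
- exact/measurable_EFinP.
- by move=> x _; rewrite lee_fin exprn_ge0// cabs_ge0.
by rewrite integral_cst_mass lte_add_pinfty// ltry.
Qed.

Lemma power_cmean_le (k : nat) (g : T -> R[i]) : cintegrable mu g ->
  ((m * cabs (m^-1%:C%C * cintegral mu setT g) ^+ k)%:E <=
    \int[mu]_x (cabs (g x) ^+ k)%:E)%E.
Proof.
move=> gi; apply: le_trans (power_mean_le k _ (cintegrable_cabs gi)).
  rewrite lee_fin ler_wpM2l ?(ltW m0)// lerXn2r ?nnegrE ?cabs_ge0//.
    by rewrite mulr_ge0 ?invr_ge0 ?(ltW m0)// Rintegral_ge0// => x _; exact: cabs_ge0.
  rewrite cabsM cabs_real ger0_norm ?invr_ge0 ?(ltW m0)//.
  rewrite ler_wpM2l ?invr_ge0 ?(ltW m0)// -lee_fin.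
  have cf := integrable_fin_num measurableT (cintegrable_cabs gi).
  by rewrite /Rintegral fineK// le_cabs_cintegral.
by move=> x; exact: cabs_ge0.
Qed.

End power_mean.

(** * Iterated integrals of nonnegative functions *)

Section iterated_integral.
Context {R : realType} d1 d2 (T1 : measurableType d1) (T2 : measurableType d2).
Variables (mu1 : {finite_measure set T1 -> \bar R})
          (mu2 : {finite_measure set T2 -> \bar R}).
Implicit Types F G : T1 * T2 -> R.

Definition iterint F : \bar R := (\int[mu1]_x \int[mu2]_y (F (x, y))%:E)%E.

Lemma measurable_section1 F x :
  measurable_fun setT F -> measurable_fun setT (fun y => F (x, y)).
Proof. by move=> mF; apply: (measurableT_comp mF). Qed.

Lemma measurable_section2 F y :
  measurable_fun setT F -> measurable_fun setT (fun x => F (x, y)).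
Proof. by move=> mF; apply: (measurableT_comp mF). Qed.

Lemma measurable_fun_fst (A : T1 -> R) : measurable_fun setT A ->
  measurable_fun setT (fun z : T1 * T2 => A z.1).
Proof. by move=> mA; apply: (measurableT_comp mA). Qed.

Lemma measurable_fun_snd (A : T2 -> R) : measurable_fun setT A ->
  measurable_fun setT (fun z : T1 * T2 => A z.2).
Proof. by move=> mA; apply: (measurableT_comp mA). Qed.

Lemma measurable_inner_integral F : measurable_fun setT F -> (forall z, 0 <= F z) ->
  measurable_fun setT (fun x => \int[mu2]_y (F (x, y))%:E)%E.
Proof.
move=> mF F0; apply: (measurable_fun_fubini_tonelli_F (EFin \o F)).
  exact/measurable_EFinP.
by move=> z; rewrite lee_fin.
Qed.

Lemma iterint_ge0 F : (forall z, 0 <= F z) -> (0 <= iterint F)%E.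
Proof.
by move=> F0; apply: integral_ge0 => x _; apply: integral_ge0 => y _; rewrite lee_fin.
Qed.

Lemma iterintC F : measurable_fun setT F -> (forall z, 0 <= F z) ->
  iterint F = (\int[mu2]_y \int[mu1]_x (F (x, y))%:E)%E.
Proof.
move=> mF F0; apply: (fubini_tonelli (EFin \o F)); first exact/measurable_EFinP.
by move=> z; rewrite lee_fin.
Qed.

Lemma le_iterint F G : measurable_fun setT F -> measurable_fun setT G ->
  (forall z, 0 <= F z <= G z) -> (iterint F <= iterint G)%E.
Proof.
move=> mF mG FG.
have F0 z : 0 <= F z by case/andP: (FG z).
have G0 z : 0 <= G z by case/andP: (FG z) => /le_trans; apply.
apply: ge0_le_integral => //.
- by move=> x _; apply: integral_ge0 => y _; rewrite lee_fin.
- exact: measurable_inner_integral.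
- exact: measurable_inner_integral.
- move=> x _; apply: ge0_le_integral => //.
  + by move=> y _; rewrite lee_fin.
  + by apply/measurable_EFinP; exact: measurable_section1.
  + by apply/measurable_EFinP; exact: measurable_section1.
  + by move=> y _; rewrite lee_fin; case/andP: (FG (x, y)).
Qed.

Lemma iterintD F G : measurable_fun setT F -> measurable_fun setT G ->
  (forall z, 0 <= F z) -> (forall z, 0 <= G z) ->
  (iterint (fun z => (F z + G z)%R) = iterint F + iterint G)%E.
Proof.
move=> mF mG F0 G0; rewrite /iterint -ge0_integralD//=; first last.
- exact: measurable_inner_integral.
- by move=> x _; apply: integral_ge0 => y _; rewrite lee_fin.
- exact: measurable_inner_integral.
- by move=> x _; apply: integral_ge0 => y _; rewrite lee_fin.
apply: eq_integral => x _; rewrite -ge0_integralD//=.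
- by move=> y _; rewrite lee_fin.
- by apply/measurable_EFinP; exact: measurable_section1.
- by move=> y _; rewrite lee_fin.
- by apply/measurable_EFinP; exact: measurable_section1.
Qed.

Lemma iterintZ (a : R) F : 0 <= a -> measurable_fun setT F ->
  (forall z, 0 <= F z) -> (iterint (fun z => (a * F z)%R) = a%:E * iterint F)%E.
Proof.
move=> a0 mF F0; rewrite /iterint -ge0_integralZl//=; first last.
- by move=> x _; apply: integral_ge0 => y _; rewrite lee_fin.
- exact: measurable_inner_integral.
apply: eq_integral => x _; rewrite -ge0_integralZl//=.
- by apply/measurable_EFinP; exact: measurable_section1.
- by move=> y _; rewrite lee_fin.
Qed.

Lemma iterint_fst (m : R) (A : T1 -> R) : mu2 setT = m%:E ->
  measurable_fun setT A -> (forall x, 0 <= A x) ->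
  (iterint (fun z => A z.1) = m%:E * \int[mu1]_x (A x)%:E)%E.
Proof.
move=> mu2T mA A0; have m0 : (0 <= m%:E)%E by rewrite -mu2T.
rewrite /iterint -ge0_integralZl//.
- apply: eq_integral => x _; rewrite muleC.
  by apply: etrans (integral_cst mu2 measurableT (A x)%:E) _; congr (_ * _)%E.
- exact/measurable_EFinP.
- by move=> x _; rewrite lee_fin.
Qed.

Lemma iterint_snd (m : R) (A : T2 -> R) : mu1 setT = m%:E ->
  measurable_fun setT A -> (forall y, 0 <= A y) ->
  (iterint (fun z => A z.2) = m%:E * \int[mu2]_y (A y)%:E)%E.
Proof.
move=> mu1T mA A0; have m0 : (0 <= m%:E)%E by rewrite -mu1T.
rewrite iterintC//; last exact: measurable_fun_snd.
rewrite -ge0_integralZl//.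
- apply: eq_integral => x _; rewrite muleC.
  by apply: etrans (integral_cst mu1 measurableT (A x)%:E) _; congr (_ * _)%E.
- exact/measurable_EFinP.
- by move=> x _; rewrite lee_fin.
Qed.

End iterated_integral.

(** * Oscillation and tested kernels *)

Lemma mean_cst {R : realType} d (T : measurableType d)
    (mu : {finite_measure set T -> \bar R}) (m : R) (c : R[i]) :
  0 < m -> mu setT = m%:E ->
  m^-1%:C%C * cintegral mu setT (fun _ => c) = c.
Proof.
move=> m0 muT.
have icst (r : R) : (\int[mu]_x r = r * m)%R.
  rewrite /Rintegral; have -> : (\int[mu]_x r%:E = (r * m)%:E)%E => //.
  by apply: etrans (integral_cst mu measurableT r%:E) _; rewrite EFinM; congr (_ * _)%E.
rewrite /cintegral !icst; case: c => p q /=; apply/eqP; rewrite eq_complex /=.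
by apply/andP; split; apply/eqP; field; rewrite gt_eqF.
Qed.

(** The exponent of the smallness condition collects [k + 1] from the rank bound,
[k] from the splitting of [h] and [k + 2] from the two oscillations; one more
factor [2] leaves half of [K0 * S] after the error [X] is absorbed. *)
Lemma absorb_error {R : realFieldType} (k : nat) (K0 eps S B X : R) :
  0 < K0 -> 0 <= S -> 0 <= B + X -> 2 ^+ (3 * k + 4) * eps <= 1 ->
  S <= (2 ^+ k.+1 - 1) * ((B + X) / K0) ->
  X <= 2 ^+ k * (eps * K0) * (2 ^+ k.+2 * S) -> K0 * S <= 2 ^+ k.+2 * B.
Proof.
move=> K00 S0 BX0 epsle rk Xle.
have H1 : K0 * S <= 2 ^+ k.+1 * (B + X).
  move: rk; rewrite mulrA ler_pdivlMr// mulrC => /le_trans; apply.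
  by rewrite ler_wpM2r// gerBl.
have H2 : 2 ^+ k.+1 * X <= K0 * S / 2.
  apply: le_trans (ler_wpM2l _ Xle) _; first exact: exprn_ge0.
  have -> : 2 ^+ k.+1 * (2 ^+ k * (eps * K0) * (2 ^+ k.+2 * S)) =
            (2 ^+ (3 * k + 4) * eps) * (K0 * S) / 2.
    rewrite (_ : (3 * k + 4)%N = (k.+1 + k + k.+2 + 1)%N); last by lia.
    by rewrite !exprD expr1 -[2 ^+ k.+2]/(2 ^+ k.+2); field.
  by rewrite ler_wpM2r ?invr_ge0// ler_piMl// mulr_ge0// ltW.
rewrite mulrDr in H1; rewrite (exprS _ k.+1); lra.
Qed.

Section oscillation.
Context {R : realType} d1 d2 (T1 : measurableType d1) (T2 : measurableType d2).
Variables (mu1 : {finite_measure set T1 -> \bar R})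
          (mu2 : {finite_measure set T2 -> \bar R}) (m : R).
Hypotheses (m0 : 0 < m) (mu1T : mu1 setT = m%:E) (mu2T : mu2 setT = m%:E).

Local Notation dint := (iterint mu1 mu2).

(** [b1] and [b2] are the restrictions of one function to two cubes. The kernel
error [E] is only small after integration in one variable, hence the detour
through the oscillations of [b1] and [b2] around a constant, which depend on one
variable each and are controlled by the double integral of [h]. *)
Lemma oscillation_le_operator_norm (k : nat) (b1 : T1 -> R[i]) (b2 : T2 -> R[i])
    (E : T1 * T2 -> R) (K0 eps B : R) :
  (0 < k)%N -> 0 < K0 -> 0 <= eps -> 2 ^+ (3 * k + 4) * eps <= 1 ->
  cmeasurable setT b1 -> (\int[mu1]_x (cabs (b1 x) ^+ k)%:E < +oo)%E ->
  cmeasurable setT b2 -> (\int[mu2]_y (cabs (b2 y) ^+ k)%:E < +oo)%E ->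
  measurable_fun setT E -> (forall z, 0 <= E z) ->
  (forall x, \int[mu2]_y (E (x, y))%:E <= (eps * K0 * m)%:E)%E ->
  (forall y, \int[mu1]_x (E (x, y))%:E <= (eps * K0 * m)%:E)%E ->
  (forall f, cmeasurable setT f -> (forall y, cabs (f y) <= 1) ->
    (K0%:E * (\int[mu1]_x
       (cabs (cintegral mu2 setT (fun y => (b1 x - b2 y) ^+ k * f y)))%:E) <=
    B%:E + \int[mu1]_x \int[mu2]_y (cabs (b1 x - b2 y) ^+ k * E (x, y))%:E)%E) ->
  ((m * K0)%:E * (\int[mu2]_y
      (cabs (b2 y - m^-1%:C%C * cintegral mu2 setT b2) ^+ k)%:E) <=
    (2 ^+ (2 * k + 3) * B)%:E)%E.
Proof.
have expE : (2 * k + 3)%N = (k.+1 + k.+2)%N by lia.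
move=> k0 K00 eps0 epsle mb1 b1k mb2 b2k mE E0 E1 E2 Hop; set c := _ * cintegral mu2 _ b2.
have m0' := ltW m0.
have pow2_ge0 : 0 <= 2 ^+ k :> R by exact: exprn_ge0.
pose h x y : R := cabs (b1 x - b2 y) ^+ k.
have h0 x y : 0 <= h x y by rewrite exprn_ge0// cabs_ge0.
have mb1z : cmeasurable setT (fun z : T1 * T2 => b1 z.1).
  exact: (cmeasurable_comp measurable_fst).
have mb2z : cmeasurable setT (fun z : T1 * T2 => b2 z.2).
  exact: (cmeasurable_comp measurable_snd).
have mh : measurable_fun setT (fun z : T1 * T2 => h z.1 z.2).
  by apply: measurable_funX; apply: measurable_cabs; exact: cmeasurableB.
have b2i : cintegrable mu2 b2.
  exact: (cintegrable_pow_le mu2T (j := 1) k0 mb2 b2k).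
have mhx x : measurable_fun setT (h x).
  by apply: measurable_funX; apply: measurable_cabs; exact: cmeasurableB.
pose A1 x : R := cabs (b1 x - c) ^+ k.
pose A2 y : R := cabs (b2 y - c) ^+ k.
have A10 x : 0 <= A1 x by rewrite exprn_ge0// cabs_ge0.
have A20 y : 0 <= A2 y by rewrite exprn_ge0// cabs_ge0.
have mA1 : measurable_fun setT A1.
  apply: measurable_funX; apply: measurable_cabs; exact: (cmeasurableB mb1).
have mA2 : measurable_fun setT A2.
  apply: measurable_funX; apply: measurable_cabs; exact: (cmeasurableB mb2).
pose hz (z : T1 * T2) := h z.1 z.2.
have hz0 z : 0 <= hz z by exact: h0.
(* finiteness of the double integral is what allows the error to be absorbed *)
have Sfin : dint hz \is a fin_num.
  rewrite ge0_fin_numE; last by apply: integral_ge0 => x _; apply: integral_ge0 => y _; rewrite lee_fin.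
  have mp1 : measurable_fun setT (fun x => cabs (b1 x) ^+ k).
    by apply: measurable_funX; exact: measurable_cabs.
  have mp2 : measurable_fun setT (fun x => cabs (b2 x) ^+ k).
    by apply: measurable_funX; exact: measurable_cabs.
  apply: (@le_lt_trans _ _ (dint (fun z =>
    2 ^+ k * cabs (b1 z.1) ^+ k + 2 ^+ k * cabs (b2 z.2) ^+ k))).
    apply: le_iterint => //.
      by apply: measurable_funD; apply: measurable_funM => //; [exact: (measurable_fun_fst mp1)|exact: (measurable_fun_snd mp2)].
    move=> z; rewrite hz0 /= -mulrDr; apply: le_trans (cabsD_expr _ _ _) _.
    by rewrite cabsN.
  rewrite iterintD.
  - rewrite !iterintZ ?exprn_ge0//; first last.
    + by move=> z; rewrite exprn_ge0 ?cabs_ge0.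
    + exact: (measurable_fun_fst mp1).
    + by move=> z; rewrite exprn_ge0 ?cabs_ge0.
    + exact: (measurable_fun_snd mp2).
    rewrite (iterint_fst mu1 mu2T mp1) ?(iterint_snd mu2 mu1T mp2)//; first last.
    + by move=> z; rewrite exprn_ge0 ?cabs_ge0.
    + by move=> z; rewrite exprn_ge0 ?cabs_ge0.
    by rewrite lte_add_pinfty// lte_mul_pinfty// ?lee_fin ?exprn_ge0//
      ?mule_ge0 ?lee_fin ?lte_mul_pinfty// ?lee_fin// integral_ge0// => x _;
      rewrite lee_fin exprn_ge0 ?cabs_ge0.
  - by apply: measurable_funM => //; exact: (measurable_fun_fst mp1).
  - by apply: measurable_funM => //; exact: (measurable_fun_snd mp2).
  - by move=> z; rewrite mulr_ge0 ?exprn_ge0 ?cabs_ge0.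
  - by move=> z; rewrite mulr_ge0 ?exprn_ge0 ?cabs_ge0.
pose S := fine (dint hz).
have SE : dint hz = S%:E by rewrite fineK.
have S0 : 0 <= S by rewrite fine_ge0// iterint_ge0.
(* Jensen's inequality in y, as b1 x - c is the mean of b1 x - b2 y *)
have I1le : (m%:E * \int[mu1]_x (A1 x)%:E <= S%:E)%E.
  rewrite -SE -ge0_integralZl//; first last.
  - by move=> x _; rewrite lee_fin.
  - exact/measurable_EFinP.
  apply: ge0_le_integral => //.
  - by move=> x _; rewrite -EFinM lee_fin mulr_ge0.
  - by apply: measurable_funeM; exact/measurable_EFinP.
  - exact: measurable_inner_integral.
  move=> x _; have ci := cintegrable_cst mu2T (b1 x).
  have := power_cmean_le m0 mu2T k (cintegrableB ci b2i).
  by rewrite cintegralB// mulrBr (mean_cst _ m0 mu2T).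
have I2le : (m%:E * \int[mu2]_y (A2 y)%:E <= (2 ^+ k.+1 * S)%:E)%E.
  rewrite -(iterint_snd mu2 mu1T mA2)//.
  apply: (@le_trans _ _ (dint (fun z => 2 ^+ k * hz z + 2 ^+ k * A1 z.1))).
    apply: le_iterint.
    - exact: measurable_fun_snd.
    - by apply: measurable_funD; apply: measurable_funM => //; exact: measurable_fun_fst.
    - move=> z; rewrite A20 /= -mulrDr /A2.
      rewrite (_ : b2 z.2 - c = (b2 z.2 - b1 z.1) + (b1 z.1 - c)); last by ring.
      by apply: le_trans (cabsD_expr _ _ _) _; rewrite cabs_distC.
  rewrite iterintD; last 4 first.
  - exact: measurable_funM.
  - by apply: measurable_funM => //; exact: measurable_fun_fst.
  - by move=> z; rewrite mulr_ge0.
  - by move=> z; rewrite mulr_ge0.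
  rewrite !iterintZ ?exprn_ge0//; last exact: measurable_fun_fst.
  rewrite SE (iterint_fst mu1 mu2T mA1)//.
  rewrite exprS -mulrA mulr_natl mulr2n EFinD EFinM leeD2l//.
  by rewrite lee_wpmul2l ?lee_fin ?exprn_ge0.
have hE0 z : 0 <= hz z * E z by rewrite mulr_ge0.
pose X := dint (fun z => hz z * E z).
have Xle : (X <= (2 ^+ k * (eps * K0) * (2 ^+ k.+2 * S))%:E)%E.
  apply: (@le_trans _ _ (dint (fun z =>
    2 ^+ k * (A1 z.1 * E z) + 2 ^+ k * (A2 z.2 * E z)))).
    apply: le_iterint.
    - exact: measurable_funM.
    - apply: measurable_funD; apply: measurable_funM => //; apply: measurable_funM => //.
        exact: measurable_fun_fst.
      exact: measurable_fun_snd.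
    - move=> z; rewrite hE0 /= -mulrDr -mulrDl mulrA ler_wpM2r// /hz /h.
      rewrite (_ : b1 z.1 - b2 z.2 = (b1 z.1 - c) + - (b2 z.2 - c)); last by ring.
      by apply: le_trans (cabsD_expr _ _ _) _; rewrite cabsN.
  have mA1E : measurable_fun setT (fun z : T1 * T2 => A1 z.1 * E z).
    by apply: measurable_funM => //; exact: measurable_fun_fst.
  have mA2E : measurable_fun setT (fun z : T1 * T2 => A2 z.2 * E z).
    by apply: measurable_funM => //; exact: measurable_fun_snd.
  have A1E0 z : 0 <= A1 z.1 * E z by rewrite mulr_ge0.
  have A2E0 (z : T1 * T2) : 0 <= A2 z.2 * E z by rewrite mulr_ge0.
  rewrite iterintD; last 4 first.
  - exact: measurable_funM.
  - exact: measurable_funM.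
  - by move=> z; rewrite mulr_ge0.
  - by move=> z; rewrite mulr_ge0.
  rewrite !iterintZ ?exprn_ge0//.
  have X1 : (dint (fun z => (A1 z.1 * E z)%R) <= (eps * K0 * S)%:E)%E.
    apply: (@le_trans _ _ (\int[mu1]_x ((eps * K0 * m)%:E * (A1 x)%:E))%E).
      apply: ge0_le_integral => //.
      - by move=> x _; apply: integral_ge0 => y _; rewrite lee_fin.
      - exact: (measurable_inner_integral mu2 mA1E).
      - by apply: measurable_funeM; exact/measurable_EFinP.
      - move=> x _ /=; under eq_integral do rewrite EFinM.
        rewrite ge0_integralZl//.
        + by rewrite muleC lee_wpmul2r// lee_fin.
        + by apply/measurable_EFinP; exact: measurable_section1.
        + by move=> y _; rewrite lee_fin.
        + by rewrite lee_fin.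
    rewrite ge0_integralZl//; first last.
    - by rewrite lee_fin !mulr_ge0// ltW.
    - by move=> x _; rewrite lee_fin.
    - exact/measurable_EFinP.
    by rewrite (EFinM _ m) -muleA (EFinM _ S) lee_wpmul2l// lee_fin mulr_ge0// ltW.
  have X2 : (dint (fun z => (A2 z.2 * E z)%R) <= (eps * K0 * (2 ^+ k.+1 * S))%:E)%E.
    rewrite iterintC//.
    apply: (@le_trans _ _ (\int[mu2]_y ((eps * K0 * m)%:E * (A2 y)%:E))%E).
      apply: ge0_le_integral => //.
      - by move=> x _; apply: integral_ge0 => y _; rewrite lee_fin.
      - apply: (measurable_fun_fubini_tonelli_G (fun z : T1 * T2 => (A2 z.2 * E z)%:E)).
          exact/measurable_EFinP.
        by move=> z; rewrite lee_fin.
      - by apply: measurable_funeM; exact/measurable_EFinP.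
      - move=> y _ /=; under eq_integral do rewrite EFinM.
        rewrite ge0_integralZl//.
        + by rewrite muleC lee_wpmul2r// lee_fin.
        + by apply/measurable_EFinP; apply: (measurableT_comp mE).
        + by move=> x _; rewrite lee_fin.
        + by rewrite lee_fin.
    rewrite ge0_integralZl//; first last.
    - by rewrite lee_fin !mulr_ge0// ltW.
    - by move=> x _; rewrite lee_fin.
    - exact/measurable_EFinP.
    rewrite (EFinM _ m) -muleA (EFinM _ (_ * S)) lee_wpmul2l//.
    by rewrite lee_fin mulr_ge0// ltW.
  apply: (@le_trans _ _ ((2 ^+ k)%:E * (eps * K0 * S)%:E +
     (2 ^+ k)%:E * (eps * K0 * (2 ^+ k.+1 * S))%:E)%E).
    by apply: leeD; rewrite lee_wpmul2l// lee_fin exprn_ge0.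
  rewrite -!EFinM -EFinD lee_fin.
  rewrite [leLHS](_ : _ = 2 ^+ k * (eps * K0) * (S + 2 ^+ k.+1 * S)); last by ring.
  rewrite ler_wpM2l ?mulr_ge0 ?(ltW K00)// (exprS _ k.+1).
  have : 1 * S <= 2 ^+ k.+1 * S by rewrite ler_wpM2r// exprn_ege1// ler1n.
  by rewrite mul1r; lra.
have X0 : (0 <= X)%E by apply: integral_ge0 => x _; apply: integral_ge0 => y _; rewrite lee_fin.
have Xfin : X \is a fin_num.
  by rewrite ge0_fin_numE//; apply: le_lt_trans Xle _; rewrite ltry.
pose X' := fine X.
have XE : X = X'%:E by rewrite fineK.
(* The binomial formula gives h rank k + 1. The families of factors are indexed
   by all naturals, and the minimum keeps v i integrable where the binomial
   coefficient vanishes. *)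
pose u i x := b1 x ^+ (k - i).
pose v i y := (((-1) ^+ i) *+ 'C(k, i)) * b2 y ^+ minn i k.
have ui i : cintegrable mu1 (u i).
  by apply: (cintegrable_pow_le mu1T _ mb1 b1k); exact: leq_subr.
have vi i : cintegrable mu2 (v i).
  apply: cintegrableZ; apply: (cintegrable_pow_le mu2T _ mb2 b2k).
  exact: geq_minr.
have hsum x y : (b1 x - b2 y) ^+ k = \sum_(i < k.+1) u i x * v i y.
  rewrite exprBn; apply: eq_bigr => i _; rewrite /u /v.
  have -> : minn i k = i by apply/minn_idPl; rewrite -ltnS.
  by rewrite mulrnAl mulrnAr mulrA (mulrC (b1 x ^+ _)).
have rk : (dint hz <= ((2 ^+ k.+1 - 1) * ((B + X') / K0))%:E)%E.
  have := @finite_rank_L1_le_operator_norm R _ _ _ _ mu1 mu2 k.+1 u v ((B + X') / K0) ui vi.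
  rewrite (_ : dint hz = \int[mu1]_x \int[mu2]_y
      (cabs (\sum_(i < k.+1) u i x * v i y))%:E)%E; last first.
    apply: eq_integral => x _; apply: eq_integral => y _.
    by rewrite /hz /h -hsum cabsX.
  apply => f mf fle.
  have hsumE x : (fun y => (\sum_(i < k.+1) u i x * v i y) * f y) =
      (fun y => (b1 x - b2 y) ^+ k * f y) by apply/funext => y; rewrite hsum.
  under eq_integral do rewrite hsumE.
  rewrite (mulrC (B + X')) EFinM lee_pdivlMl; last exact: K00.
  by rewrite EFinD -XE; apply: Hop.
have X'0 : 0 <= X' by rewrite fine_ge0.
rewrite SE lee_fin in rk; rewrite XE lee_fin in Xle.
have B0 : 0 <= B + X'.
  rewrite -lee_fin EFinD -XE.
  have zle (y : T2) : cabs (0 : R[i]) <= 1 by rewrite cabs0.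
  apply: le_trans _ (Hop (fun _ => 0) (cmeasurable_cst _ _) zle).
  by rewrite mule_ge0 ?cabs_integral_ge0// lee_fin ltW.
have key := absorb_error K00 S0 B0 epsle rk Xle.
rewrite mulrC EFinM -muleA.
apply: (@le_trans _ _ (K0%:E * (2 ^+ k.+1 * S)%:E)%E).
  by rewrite lee_wpmul2l// lee_fin ltW.
rewrite -EFinM lee_fin mulrCA.
by rewrite expE exprD -mulrA ler_wpM2l// exprn_ge0.
Qed.

End oscillation.

(** * The Lebesgue measure under affine maps *)

Section boxes.
Context {R : realType} {n : nat}.
Local Notation V := 'rV[R]_n.
Local Notation mu := (@lebesgue_rV R n).

Definition box (a c : V) : set V :=
  [set x | forall i, a ord0 i <= x ord0 i <= c ord0 i].

Lemma measurable_box a c : measurable (box a c).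
Proof.
rewrite [box a c](_ : _ = \bigcap_(i in [set: 'I_n])
    (rV_coor i @^-1` `[a ord0 i, c ord0 i]%classic)); last first.
  apply/seteqP; split=> x /= H i.
    by move=> _; rewrite /= in_itv; exact: H.
  by have := H i I; rewrite /= in_itv.
apply: fin_bigcap_measurable => // i _.
by rewrite -[X in measurable X]setTI; exact: measurable_coor.
Qed.

Lemma box_eq0 (a c : V) i : c ord0 i < a ord0 i -> box a c = set0.
Proof.
move=> ca; apply/seteqP; split => // x /(_ i) /andP[ax xc].
by have := le_lt_trans (le_trans ax xc) ca; rewrite ltxx.
Qed.

Definition boxes : set (set V) := [set A | exists a c, A = box a c].

Lemma setI_closed_boxes : setI_closed boxes.
Proof.
move=> _ _ [a [c ->]] [a' [c' ->]].
exists (\row_i Num.max (a ord0 i) (a' ord0 i)),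
       (\row_i Num.min (c ord0 i) (c' ord0 i)).
apply/seteqP; split => x /=.
  move=> [H H'] i; rewrite !mxE ge_max le_min.
  by have /andP[-> ->] := H i; have /andP[-> ->] := H' i.
by move=> H; split=> i; have := H i; rewrite !mxE ge_max le_min => ?; lra.
Qed.

Lemma boxes_cover : \bigcup_k box (const_mx (- k%:R)) (const_mx k%:R) = [set: V].
Proof.
apply/seteqP; split => // x _.
pose N := \max_(i < n) Num.truncn `|x ord0 i|.
exists N.+1 => // i; rewrite !mxE -ler_norml.
apply: (le_trans (ltW (truncnS_gt _))).
by rewrite ler_nat ltnS; apply: (leq_bigmax i).
Qed.

Lemma measurable_boxesE : @measurable _ V = <<s boxes >>.
Proof.
apply/seteqP; split; last first.
  apply: smallest_sub; first exact: sigma_algebra_measurable.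
  by move=> _ [a [c ->]]; exact: measurable_box.
apply: smallest_sub; first exact: smallest_sigma_algebra.
move=> A; rewrite -bigcup_seq => -[i _ [B mB <-]].
have mi : measurable_fun [set: g_sigma_algebraType boxes]
    (rV_coor i : g_sigma_algebraType boxes -> R).
  apply: (measurability _ (RGenCInfty.measurableE R)).
  move=> _ [_ [x ->] <-]; rewrite setTI.
  pose lo k : V := \row_j if j == i then x else - k%:R.
  rewrite [X in measurable X](_ : _ = \bigcup_k box (lo k) (const_mx k%:R)).
    apply: bigcupT_measurable => k; apply: sub_sigma_algebra.
    by exists (lo k), (const_mx k%:R).
  apply/seteqP; split => [y /=|y [k _] /(_ i)]; rewrite /= in_itv /= andbT.
    move=> xy; have : [set: V] y by [].
    rewrite -boxes_cover => -[k _ yk]; exists k => // j; rewrite !mxE.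
    have /andP[H1 H2] := yk j; rewrite !mxE in H1 H2; rewrite H2 andbT.
    by case: eqP => [->|].
  by rewrite !mxE eqxx => /andP[].
by have := mi measurableT B mB.
Qed.

Lemma lebesgue_rV_box_lty a c : (mu (box a c) < +oo)%E.
Proof.
have [ac|] := pselect (forall i, a ord0 i <= c ord0 i).
  by rewrite lebesgue_rV_box// ltry.
move=> /existsNP[i /negP]; rewrite -ltNge => /box_eq0 ->.
by rewrite measure0 ltry.
Qed.

Lemma measurable_affine (a : V) (c : R) :
  measurable_fun setT (fun x : V => a + c *: x).
Proof.
apply/measurable_fun_coorP => i.
apply: (eq_measurable_fun (fun x : V => a ord0 i + c * x ord0 i)).
  by move=> x _; rewrite !mxE.
apply: measurable_funD => //; apply: measurable_funM => //; exact: measurable_coor.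
Qed.

Lemma lebesgue_rV_preimage_box (a : V) (c : R) u v : c != 0 ->
  mu ((fun x : V => a + c *: x) @^-1` box u v) = ((`|c| ^+ n)^-1%:E * mu (box u v))%E.
Proof.
move=> c0.
have [uv|] := pselect (forall i, u ord0 i <= v ord0 i); last first.
  move=> /existsNP[i /negP]; rewrite -ltNge => /box_eq0 ->.
  by rewrite preimage_set0 !measure0 mule0.
rewrite [in RHS]lebesgue_rV_box// -EFinM.
have prodE : (`|c| ^+ n)^-1 * (\prod_(i < n) (v ord0 i - u ord0 i)) =
    \prod_(i < n) ((v ord0 i - u ord0 i) / `|c|).
  by rewrite big_split /= prodr_const card_ord exprVn mulrC.
rewrite prodE.
have [cp|cn|/eqP] := ltgtP 0 c; last by rewrite eq_sym (negbTE c0).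
  rewrite (_ : _ @^-1` _ = box (\row_i ((u ord0 i - a ord0 i) / c))
                              (\row_i ((v ord0 i - a ord0 i) / c))).
    rewrite lebesgue_rV_box; last first.
      by move=> i; rewrite !mxE ler_pM2r ?invr_gt0// lerD2r.
    congr EFin; apply: eq_bigr => i _; rewrite !mxE gtr0_norm// -mulrBl.
    by congr (_ / _); ring.
  apply/seteqP; split => x /= H i; have := H i;
    by rewrite !mxE ler_pdivrMr// ler_pdivlMr// lerBlDl lerBrDl (mulrC c).
rewrite (_ : _ @^-1` _ = box (\row_i ((v ord0 i - a ord0 i) / c))
                            (\row_i ((u ord0 i - a ord0 i) / c))).
  rewrite lebesgue_rV_box; last first.
    by move=> i; rewrite !mxE ler_nM2r ?invr_lt0// lerD2r.
  congr EFin; apply: eq_bigr => i _; rewrite !mxE ltr0_norm// -mulrBl.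
  by rewrite invrN mulrN -mulNr; congr (_ / _); ring.
apply/seteqP; split => x /= H i; have := H i;
  by rewrite !mxE ler_ndivrMr// ler_ndivlMr// lerBlDl lerBrDl (mulrC c) andbC.
Qed.

(** Both sides are measures that agree on boxes. *)
Lemma lebesgue_rV_affine (a : V) (c : R) A : c != 0 -> measurable A ->
  mu ((fun x : V => a + c *: x) @^-1` A) = ((`|c| ^+ n)^-1%:E * mu A)%E.
Proof.
move=> c0 mA.
have k0 : 0 <= (`|c| ^+ n)^-1 by rewrite invr_ge0 exprn_ge0.
apply: (measure_unique boxes (fun k => box (const_mx (- k%:R)) (const_mx k%:R))
  measurable_boxesE setI_closed_boxes _ boxes_cover
  (pushforward mu (fun x : V => a + c *: x)) (mscale (NngNum k0) mu)) => //=.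
- by move=> k; exists (const_mx (- k%:R)), (const_mx k%:R).
- exact: measurable_affine.
- by move=> _ _ [u [v ->]]; exact: lebesgue_rV_preimage_box.
- move=> _ k; rewrite /pushforward /= lebesgue_rV_preimage_box//.
  by rewrite lte_mul_pinfty ?lee_fin// lebesgue_rV_box_lty.
Qed.

Lemma ge0_integral_affine (a : V) (c : R) (f : V -> \bar R) : c != 0 ->
  measurable_fun setT f -> (forall x, 0 <= f x)%E ->
  (\int[mu]_x f (a + c *: x)%R = (`|c| ^+ n)^-1%:E * \int[mu]_x f x)%E.
Proof.
move=> c0 mf f0.
have k0 : 0 <= (`|c| ^+ n)^-1 by rewrite invr_ge0 exprn_ge0.
rewrite -(ge0_integral_mscale mu measurableT (NngNum k0))//.
have := @ge0_integral_pushforward _ _ _ _ _ _ (measurable_affine a c) mu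
  setT f measurableT mf (fun x _ => f0 x).
rewrite preimage_setT /= => <-.
apply: eq_measure_integral => /= [|? A mA _]; first exact: measurable_affine.
exact: (lebesgue_rV_affine a c0 mA).
Qed.

End boxes.

(** * The Euclidean norm and cubes *)

Section euclidean_norm.
Context {R : realType} {n : nat}.
Local Notation V := 'rV[R]_n.
Implicit Types x y : V.

Lemma enorm_ge0 x : 0 <= enorm x.
Proof. exact: sqrtr_ge0. Qed.

Lemma enorm_sqr x : enorm x ^+ 2 = \sum_i x ord0 i ^+ 2.
Proof. by rewrite sqr_sqrtr// sumr_ge0// => i _; exact: sqr_ge0. Qed.

Lemma coor_le_enorm x i : `|x ord0 i| <= enorm x.
Proof.
rewrite -sqrtr_sqr ler_wsqrtr// (bigD1 i)//= lerDl sumr_ge0// => j _.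
exact: sqr_ge0.
Qed.

Lemma enorm_eq0 x : (enorm x == 0) = (x == 0).
Proof.
apply/eqP/eqP => [x0|->].
  apply/rowP => i; rewrite mxE; apply/eqP; rewrite -normr_le0 -x0.
  exact: coor_le_enorm.
by rewrite /enorm big1 ?sqrtr0// => i _; rewrite mxE expr0n.
Qed.

Lemma enormZ (c : R) x : enorm (c *: x) = `|c| * enorm x.
Proof.
rewrite /enorm -sqrtr_sqr -sqrtrM ?sqr_ge0// mulr_sumr; congr Num.sqrt.
by apply: eq_bigr => i _; rewrite mxE exprMn.
Qed.

Lemma enormN x : enorm (- x) = enorm x.
Proof. by rewrite -scaleN1r enormZ normrN1 mul1r. Qed.

Lemma enorm_distC x y : enorm (x - y) = enorm (y - x).
Proof. by rewrite -enormN opprB. Qed.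

(** The Cauchy-Schwarz inequality, from the sum of the squares of the coordinates
of [enorm y *: x - enorm x *: y]. *)
Lemma sum_mul_le_enorm x y : \sum_i x ord0 i * y ord0 i <= enorm x * enorm y.
Proof.
have [x0|xN0] := eqVneq x 0.
  rewrite big1 ?mulr_ge0 ?enorm_ge0// => i _; first by rewrite x0 mxE mul0r.
have [y0|yN0] := eqVneq y 0.
  rewrite big1 ?mulr_ge0 ?enorm_ge0// => i _; first by rewrite y0 mxE mulr0.
have xy0 : 0 < enorm x * enorm y.
  by rewrite mulr_gt0// lt_neqAle enorm_ge0 eq_sym enorm_eq0 ?xN0 ?yN0.
have : 0 <= \sum_i (enorm y * x ord0 i - enorm x * y ord0 i) ^+ 2.
  by apply: sumr_ge0 => i _; exact: sqr_ge0.
have -> : \sum_i (enorm y * x ord0 i - enorm x * y ord0 i) ^+ 2 =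
    enorm y ^+ 2 * enorm x ^+ 2 + enorm x ^+ 2 * enorm y ^+ 2
    - 2 * (enorm x * enorm y) * \sum_i x ord0 i * y ord0 i.
  transitivity (enorm y ^+ 2 * (\sum_i x ord0 i ^+ 2) +
      enorm x ^+ 2 * (\sum_i y ord0 i ^+ 2)
      - 2 * (enorm x * enorm y) * \sum_i x ord0 i * y ord0 i).
    by rewrite !mulr_sumr -big_split /= -sumrB; apply: eq_bigr => i _; ring.
  by rewrite -!enorm_sqr.
have -> : enorm y ^+ 2 * enorm x ^+ 2 + enorm x ^+ 2 * enorm y ^+ 2
    - 2 * (enorm x * enorm y) * \sum_i x ord0 i * y ord0 i =
    2 * (enorm x * enorm y) * (enorm x * enorm y - \sum_i x ord0 i * y ord0 i).
  by ring.
by rewrite pmulr_rge0 ?subr_ge0// mulr_gt0.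
Qed.

Lemma enormD x y : enorm (x + y) <= enorm x + enorm y.
Proof.
rewrite -(@ler_pXn2r _ 2)// ?nnegrE ?addr_ge0 ?enorm_ge0//.
have -> : enorm (x + y) ^+ 2 =
    enorm x ^+ 2 + enorm y ^+ 2 + 2 * \sum_i x ord0 i * y ord0 i.
  rewrite !enorm_sqr mulr_sumr -!big_split /=; apply: eq_bigr => i _.
  by rewrite !mxE; ring.
by have := sum_mul_le_enorm x y; nra.
Qed.

Lemma enormB x y : enorm (x - y) <= enorm x + enorm y.
Proof. by rewrite -(enormN y) enormD. Qed.

Lemma enorm_le_coor x (M : R) : 0 <= M -> (forall i, `|x ord0 i| <= M) ->
  enorm x <= Num.sqrt n%:R * M.
Proof.
move=> M0 xM; rewrite -[M in leRHS]ger0_norm// -sqrtr_sqr -sqrtrM//.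
rewrite ler_wsqrtr// mulr_natl -[n in leRHS](card_ord n) -sumr_const ler_sum// => i _.
by rewrite -real_normK ?num_real// lerXn2r ?nnegrE.
Qed.

End euclidean_norm.

Section cubes.
Context {R : realType} {n : nat}.
Local Notation V := 'rV[R]_n.
Local Notation mu := (@lebesgue_rV R n).

Lemma cubeE (a : V) l : cube a l = box a (a + const_mx l).
Proof. by apply/seteqP; split => x H i; have := H i; rewrite !mxE. Qed.

Lemma measurable_cube (a : V) l : measurable (cube a l).
Proof. by rewrite cubeE; exact: measurable_box. Qed.

Lemma lebesgue_cube (a : V) l : 0 <= l -> mu (cube a l) = (l ^+ n)%:E.
Proof.
move=> l0; rewrite cubeE lebesgue_rV_box => [|i]; last by rewrite !mxE lerDl.
congr EFin; rewrite (eq_bigr (fun=> l)) => [|i _]; last by rewrite !mxE addrAC subrr add0r.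
by rewrite prodr_const card_ord.
Qed.

Lemma compact_cube (a : V) l : compact (cube a l).
Proof.
rewrite (_ : cube a l =
  [set v : V | forall i, `[a ord0 i, a ord0 i + l]%classic (v ord0 i)]).
  apply: (@rV_compact R n (fun i => `[a ord0 i, a ord0 i + l]%classic)) => i.
  exact: segment_compact.
by apply/seteqP; split => x H i; have := H i; rewrite /= in_itv.
Qed.

Lemma closed_cube (a : V) l : closed (cube a l).
Proof. by apply: compact_closed; [exact: norm_hausdorff|exact: compact_cube]. Qed.

Lemma cube_corner (a : V) l : 0 <= l -> cube a l a.
Proof. by move=> l0 i; rewrite lexx lerDl. Qed.

Lemma cube_diam (a : V) l x y : 0 <= l -> cube a l x -> cube a l y ->
  enorm (x - y) <= Num.sqrt n%:R * l.
Proof.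
move=> l0 xQ yQ; apply: enorm_le_coor => // i; rewrite !mxE ler_norml.
by have := xQ i; have := yQ i; lra.
Qed.

Lemma ball_subset_cube (a : V) r x : enorm (x - a) <= r ->
  cube (a - const_mx r) (2 * r) x.
Proof.
move=> xr i; rewrite !mxE; have := le_trans (coor_le_enorm (x - a) i) xr.
by rewrite !mxE ler_norml; lra.
Qed.

(** Rational boxes form a countable base of the topology. *)
Lemma continuous_measurable_rV (D : set V) (f : V -> R) : measurable D ->
  (forall y, D y -> forall e : R, 0 < e -> exists2 del : R, 0 < del &
    forall z, D z -> enorm (z - y) < del -> `|f z - f y| < e) ->
  measurable_fun D f.
Proof.
move=> mD cf; apply: (measurability _ (RGenOInfty.measurableE R)).
move=> _ [_ [t ->] <-].
pose rb (q : 'rV[rat]_n * nat) : set V :=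
  box (\row_i (ratr (q.1 ord0 i) - q.2.+1%:R^-1))
      (\row_i (ratr (q.1 ord0 i) + q.2.+1%:R^-1)).
pose F q := if asbool (rb q `&` D `<=` [set y | t < f y]) then rb q else set0.
rewrite [X in measurable X](_ : _ = D `&` \bigcup_q F q).
  apply: measurableI => //; apply: countable_bigcupT_measurable => // q.
  by rewrite /F; case: ifP => _ //; exact: measurable_box.
apply/seteqP; split => [y [Dy]|y [Dy [q _]]]; last first.
  rewrite /F; case: ifP => // /asboolP H rqy; split => //=.
  by rewrite in_itv /= andbT; apply: H.
rewrite /= in_itv /= andbT => tfy; split => //.
have [|del del0 H] := cf y Dy (f y - t); first by rewrite subr_gt0.
pose C : R := Num.sqrt n%:R * 2 + 1.
have C0 : 0 < C by rewrite ltr_wpDl// mulr_ge0// sqrtr_ge0.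
pose k := Num.truncn (C / del).
have kdel : C / k.+1%:R < del.
  rewrite ltr_pdivrMr// mulrC -ltr_pdivrMr//.
  exact: truncnS_gt.
pose e : R := k.+1%:R^-1.
have e0 : 0 < e by rewrite invr_gt0.
have rq i : exists q : rat, y ord0 i - e < ratr q < y ord0 i + e.
  have [|q] := @rat_in_itvoo R (y ord0 i - e) (y ord0 i + e); first lra.
  by rewrite in_itv /= => qy; exists q.
have [q qy] := choice rq.
exists (\row_i q i, k) => //; rewrite /F ifT.
  by move=> i; rewrite !mxE /= -/e; have /andP[] := qy i; lra.
apply/asboolP => z [rz Dz] /=.
have : `|f z - f y| < f y - t.
  apply: H => //; apply: le_lt_trans kdel.
  apply: (@le_trans _ _ (Num.sqrt n%:R * (2 * e))).
    apply: enorm_le_coor => [|i]; first by rewrite mulr_ge0// ltW.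
    have := rz i; rewrite !mxE /= -/e ler_norml; have /andP[] := qy i; lra.
  by rewrite mulrA ler_wpM2r ?(ltW e0)// lerDl.
rewrite ltr_norml; lra.
Qed.

End cubes.

(** * Restricted measures *)

Section restricted_measure.
Context {R : realType} d (T : measurableType d) (mu : {measure set T -> \bar R})
        (D : set T) (mD : measurable D).

Lemma integral_mrestr_patch (f : T -> \bar R) :
  (\int[mrestr mu mD]_x (f \_ D) x = \int[mu]_x (f \_ D) x)%E.
Proof.
rewrite -!integral_mkcond; apply: eq_measure_integral => A mA AD.
by rewrite -[LHS]/(mu (A `&` D)) setIidl.
Qed.

Lemma ge0_integral_mrestr (f : T -> \bar R) : measurable_fun setT f ->
  (forall x, 0 <= f x)%E ->
  (\int[mrestr mu mD]_x f x = \int[mu]_(x in D) f x)%E.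
Proof.
move=> mf f0; rewrite [RHS]integral_mkcond -integral_mrestr_patch -integral_mkcond.
have -> := @ge0_negligible_integral _ _ _ (mrestr mu mD) setT (~` D) f.
- by rewrite setTD setCK.
- exact: measurableC.
- exact: measurableT.
- exact: mf.
- by move=> x _; exact: f0.
- by rewrite -[LHS]/(mu (~` D `&` D)) setICl measure0.
Qed.

Lemma ae_mrestr (P : T -> Prop) : {ae mu, forall x, D x -> P x} ->
  {ae mrestr mu mD, forall x, P x}.
Proof.
move=> [A [mA A0 PA]]; exists (A `|` ~` D); split.
- by apply: measurableU => //; exact: measurableC.
- apply/eqP; rewrite eq_le measure_ge0 andbT.
  rewrite -[leLHS]/(mu ((A `|` ~` D) `&` D)) setIUl setICl setU0 -A0.
  by apply: le_measure; rewrite ?inE//; exact: measurableI.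
- move=> x /= Px; have [Dx|] := pselect (D x); last by right.
  by left; apply: PA => /= /(_ Dx).
Qed.

End restricted_measure.

(** * Polar coordinates *)

Section polar.
Context {R : realType} {n : nat}.
Local Notation V := 'rV[R]_n.
Local Notation mu := (@lebesgue_rV R n).
Local Notation sigma := (@surface_measure R n).

Lemma measurable_sphere : measurable (@sphere R n).
Proof.
rewrite (_ : sphere = enorm @^-1` [set 1]); last by apply/seteqP; split.
by rewrite -[X in measurable X]setTI; apply: measurable_enorm.
Qed.

Lemma measurable_enorm_sub (c : V) : measurable_fun setT (fun x : V => enorm (x - c)).
Proof.
apply: (eq_measurable_fun (fun x : V => enorm (- c + 1 *: x))).
  by move=> x _; rewrite scale1r addrC.
exact: (measurableT_comp measurable_enorm (measurable_affine _ _)).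
Qed.

Definition annulus (s t : R) : set V := [set x | s <= enorm x < t].

Definition punctured_ball (r : R) : set V := [set x | 0 < enorm x < r].

Lemma measurable_annulus (s t : R) : measurable (annulus s t).
Proof.
rewrite (_ : annulus s t = enorm @^-1` `[s, t[%classic).
  by rewrite -[X in measurable X]setTI; apply: measurable_enorm.
by apply/seteqP; split => x /=; rewrite in_itv.
Qed.

Lemma measurable_punctured_ball r : measurable (punctured_ball r).
Proof.
rewrite (_ : punctured_ball r = enorm @^-1` `]0, r[%classic).
  by rewrite -[X in measurable X]setTI; apply: measurable_enorm.
by apply/seteqP; split => x /=; rewrite in_itv.
Qed.

Lemma measurable_eball (c : V) (r : R) : measurable (eball c r).
Proof.
rewrite (_ : eball c r = (fun x => enorm (x - c)) @^-1` `]-oo, r[%classic).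
  by rewrite -[X in measurable X]setTI; apply: measurable_enorm_sub.
by apply/seteqP; split => x /=; rewrite in_itv.
Qed.

Lemma normalizeZ (t : R) (x : V) : 0 < t -> normalize (t *: x) = normalize x.
Proof.
move=> t0; rewrite /normalize enormZ gtr0_norm// scalerA invfM mulrAC mulVf ?gt_eqF//.
by rewrite mul1r.
Qed.

Lemma enorm_normalize (x : V) : x != 0 -> enorm (normalize x) = 1.
Proof.
move=> x0; rewrite /normalize enormZ normfV ger0_norm ?enorm_ge0// mulVf//.
by rewrite enorm_eq0.
Qed.

Lemma enorm_sub_normalize (x : V) : x != 0 -> enorm (x - normalize x) = `|enorm x - 1|.
Proof.
move=> x0; rewrite [X in X - _](_ : x = enorm x *: normalize x).
  by rewrite -[X in _ - X]scale1r -scalerBl enormZ enorm_normalize// mulr1.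
by rewrite /normalize scalerA mulfV ?enorm_eq0// scale1r.
Qed.

(** Dilation by [r] shows that the integral of [H] over the ball of radius [r] is
[r ^+ n] times the one over the unit ball, and an annulus is the difference of
two balls. *)
Lemma integral_annulus (H : V -> R) (s t : R) : 0 < s -> s <= t ->
  measurable_fun setT H -> (forall x, 0 <= H x) ->
  (forall r x, 0 < r -> H (r *: x) = H x) ->
  (\int[mu]_(x in punctured_ball 1) (H x)%:E < +oo)%E ->
  (\int[mu]_(x in annulus s t) (H x)%:E =
   (t ^+ n - s ^+ n)%:E * \int[mu]_(x in punctured_ball 1) (H x)%:E)%E.
Proof.
move=> s0 st mH H0 hom Hoo.
have mB := measurable_punctured_ball.
have mHE : measurable_fun setT (EFin \o H) by exact/measurable_EFinP.
have dil r : 0 < r -> (\int[mu]_(x in punctured_ball r) (H x)%:E =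
    (r ^+ n)%:E * \int[mu]_(x in punctured_ball 1) (H x)%:E)%E.
  move=> r0; rewrite !(integral_mkcond (punctured_ball _)).
  have mp : measurable_fun setT ((EFin \o H) \_ (punctured_ball r)).
    by apply/(measurable_restrictT _ _).1 => //; exact: measurable_funTS.
  have p0 x : (0 <= ((EFin \o H) \_ (punctured_ball r)) x)%E.
    by rewrite patchE; case: ifP => //= _; rewrite lee_fin.
  have := ge0_integral_affine 0 (lt0r_neq0 r0) mp p0.
  rewrite gtr0_norm// => E1.
  have rn0 : r ^+ n != 0 by rewrite expf_neq0// gt_eqF.
  transitivity ((r ^+ n)%:E * ((r ^+ n)^-1%:E *
      \int[mu]_x ((EFin \o H) \_ (punctured_ball r)) x))%E.
    by rewrite muleA -EFinM mulfV// mul1e.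
  rewrite -E1; congr (_ * _)%E; apply: eq_integral => x _; rewrite add0r !patchE.
  rewrite /= hom//; congr (if _ then _ else _).
  apply/idP/idP; rewrite !inE /punctured_ball /= enormZ gtr0_norm//.
    by rewrite pmulr_rgt0// -ltr_pdivlMl// mulVf ?gt_eqF.
  by move=> /andP[x0 x1]; rewrite pmulr_rgt0// x0 /= gtr_pMr.
have t0 : 0 < t by exact: lt_le_trans st.
have B1fin : (\int[mu]_(x in punctured_ball 1) (H x)%:E)%E \is a fin_num.
  by rewrite ge0_fin_numE// integral_ge0// => x _; rewrite lee_fin.
have := @ge0_integral_setU _ _ _ mu (punctured_ball s) (annulus s t) (mB s)
  (measurable_annulus s t) (EFin \o H).
rewrite (_ : punctured_ball s `|` _ = punctured_ball t); last first.
  apply/seteqP; split => x /=.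
    move=> [/andP[x0 xs]|/andP[sx xt]]; rewrite /punctured_ball /=.
      by rewrite x0 (lt_le_trans xs).
    by rewrite xt (lt_le_trans s0).
  rewrite /punctured_ball /= => /andP[x0 xt].
  by have [sx|xs] := leP s (enorm x); [right|left]; apply/andP; split.
move=> E.
have : (\int[mu]_(x in punctured_ball t) (H x)%:E =
   \int[mu]_(x in punctured_ball s) (H x)%:E + \int[mu]_(x in annulus s t) (H x)%:E)%E.
  apply: E; first exact: measurable_funTS.
    by move=> x _ /=; rewrite lee_fin.
  apply/disj_setPS => x [/andP[_ xs] /andP[sx _]].
  by have := lt_le_trans xs sx; rewrite ltxx.
rewrite (dil t t0) (dil s s0) EFinB muleBl// => ->.
by rewrite addeAC subee ?add0e// fin_numM.
Qed.

(** The surface measure is the image under radial projection of the Lebesgue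
measure on the unit ball, up to the factor [n]. *)
Lemma integral_surface_measure (A : set V) (F : V -> R) : measurable A ->
  measurable_fun setT F -> (forall x, 0 <= F x) ->
  (\int[sigma]_(x in A) (F x)%:E =
   n%:R%:E * \int[mu]_(x in cone A) (F (normalize x))%:E)%E.
Proof.
move=> mA mF F0.
have n0 : 0 <= n%:R :> R by exact: ler0n.
have mB := measurable_punctured_ball 1.
have mFE : measurable_fun setT (EFin \o F) by exact/measurable_EFinP.
have mFn : measurable_fun setT (fun x => (F (normalize x))%:E).
  by apply/measurable_EFinP; apply: (measurableT_comp mF measurable_normalize).
have -> : (\int[sigma]_(x in A) (F x)%:E =
    \int[mscale (NngNum n0) (pushforward (mrestr mu mB) normalize)]_(x in A) (F x)%:E)%E.
  move=> mN; apply: eq_measure_integral => X mX _.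
  rewrite -[RHS]/(n%:R%:E * mu (normalize @^-1` X `&` punctured_ball 1))%E.
  congr (_ * _)%E; congr (mu _).
  by apply/seteqP; split => x [].
  exact: measurable_normalize.
move=> mN.
have mNA : measurable (normalize @^-1` A) by rewrite -[X in measurable X]setTI; apply: mN.
rewrite ge0_integral_mscale//; last 2 first.
- exact: measurable_funTS.
- by move=> x _; rewrite lee_fin.
rewrite (ge0_integral_pushforward mN)//; last 2 first.
- exact: measurable_funTS.
- by move=> x _; rewrite lee_fin.
rewrite /=; congr (_ * _)%E.
rewrite integral_mkcond ge0_integral_mrestr.
- rewrite -integral_mkcondr; congr (integral _ _ _).
- by apply/(measurable_restrictT _ _).1 => //; exact: measurable_funTS.
- by move=> x; rewrite patchE; case: ifP => //= _; rewrite lee_fin.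
Qed.

End polar.

(** * Kernels that are almost constant on pairs of cubes *)

Section almost_constant.
Context {R : realType} {n : nat}.
Local Notation V := 'rV[R]_n.
Local Notation mu := (@lebesgue_rV R n).

(** On [cube x0 l] times [cube a l] the kernel is close to the constant [K0], whose
size is comparable with the inverse of the volume of the cubes. The error is
measured by its integrals in each variable, which is all that can be controlled
for kernels without smoothness. The majorant [E] supplies the joint
measurability that Tonelli's theorem requires of the error. *)
Record almost_constant (K : V -> V -> R[i]) (eps C1 : R) (a : V) (l : R)
    (x0 : V) (K0 : R[i]) (E : V * V -> R) : Prop := AlmostConstant {
  ac_disjoint : forall x, cube x0 l x -> ~ cube a l x;
  ac_neq0 : K0 != 0;
  ac_lower : (cabs K0)^-1 <= C1 * l ^+ n;
  ac_measurable_err : measurable_fun setT E;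
  ac_err_ge0 : forall z, 0 <= E z;
  ac_err : forall x y, cube x0 l x -> cube a l y -> cabs (K x y - K0) <= E (x, y);
  ac_measurable : forall x, cube x0 l x -> cmeasurable (cube a l) (K x);
  ac_schur1 : forall x, cube x0 l x ->
    (\int[mu]_(y in cube a l) (E (x, y))%:E <= (eps * cabs K0 * l ^+ n)%:E)%E;
  ac_schur2 : forall y, cube a l y ->
    (\int[mu]_(x in cube x0 l) (E (x, y))%:E <= (eps * cabs K0 * l ^+ n)%:E)%E }.

End almost_constant.

(** * Calderon-Zygmund kernels *)

Section CZ_kernels.
Context {R : realType} {n : nat}.
Local Notation V := 'rV[R]_n.
Local Notation mu := (@lebesgue_rV R n).
Variables (omega : R -> R) (K : V -> V -> R[i]).
Hypotheses (hn : (0 < n)%N) (CZK : CZ_kernel omega K)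
  (omega0 : omega t @[t --> 0^'+] --> (0 : R)).

Let sn : R := Num.sqrt n%:R.

Let sn_gt0 : 0 < sn.
Proof. by rewrite sqrtr_gt0 ltr0n. Qed.

Let omega_small (e : R) : 0 < e -> exists2 t0 : R, 0 < t0 &
  forall t, 0 <= t -> t < t0 -> t < 1 -> omega t < e.
Proof.
move=> e0; have [om0 omm _ _] := CZK.
have /cvgrPdist_lt/(_ e e0)[d /= d0 H] := omega0.
pose t0 := Num.min (d / 2) (1 / 2).
have t00 : 0 < t0 by rewrite lt_min; apply/andP; split; lra.
have t0d : t0 <= d / 2 by rewrite ge_min lexx.
have t01 : t0 <= 1 / 2 by rewrite ge_min lexx orbT.
exists t0 => // t tge tt0 t1.
apply: (@le_lt_trans _ _ (omega t0)); first by apply: omm; lra.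
have := H t0; rewrite /= !sub0r !normrN => H'.
apply: le_lt_trans (ler_norm _) _; apply: H' => //.
rewrite gtr0_norm//; lra.
Qed.

Let CZ_measurable (a : V) l x : 0 <= l -> ~ cube a l x -> cmeasurable (cube a l) (K x).
Proof.
move=> l0 xQ; have [om0 omm _ smooth] := CZK.
have cont y : cube a l y -> forall e : R, 0 < e -> exists2 del : R, 0 < del &
    forall z, cube a l z -> enorm (z - y) < del -> cabs (K x z - K x y) < e.
  move=> yQ e e0.
  have xy : 0 < enorm (y - x).
    rewrite lt_neqAle enorm_ge0 andbT eq_sym enorm_eq0 subr_eq0.
    by apply: contra_not_neq xQ => <-.
  set D := enorm (y - x) in xy *.
  have [t0 t00 H] := omega_small (mulr_gt0 e0 (exprn_gt0 n xy)).
  exists (Num.min (D / 2) (D * t0)); first by rewrite lt_min; apply/andP; split; nra.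
  move=> z zQ; rewrite lt_min => /andP[z1 z2].
  have yz : enorm (y - z) < D / 2 by rewrite enorm_distC.
  have := smooth y z x yz; rewrite -/D => S.
  rewrite cabs_distC; apply: (@le_lt_trans _ _ ((D ^+ n)^-1 * omega (enorm (y - z) / D))).
    by apply: le_trans S; rewrite lerDr cabs_ge0.
  rewrite mulrC ltr_pdivrMr ?exprn_gt0//; apply: H.
  - by rewrite divr_ge0 ?enorm_ge0// ltW.
  - by rewrite ltr_pdivrMr// mulrC enorm_distC.
  - by rewrite ltr_pdivrMr//; lra.
split; apply: continuous_measurable_rV; try exact: measurable_cube.
  move=> y yQ e e0; have [del del0 H] := cont y yQ e e0; exists del => // z zQ zy.
  apply: le_lt_trans (H z zQ zy); apply: le_trans (normr_Re_le _).
  by case: (K x z) (K x y) => ? ? [].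
move=> y yQ e e0; have [del del0 H] := cont y yQ e e0; exists del => // z zQ zy.
apply: le_lt_trans (H z zQ zy); apply: le_trans (normr_Im_le _).
by case: (K x z) (K x y) => ? ? [].
Qed.

(** The far cube is placed at a distance [A * l] that is large compared with the
side, where the modulus of continuity makes the oscillation of [K] small
compared with its size. *)
Lemma CZ_almost_constant (c0 eps : R) : 0 < c0 -> 0 < eps ->
  (forall (y : V) (r : R), 0 < r ->
     exists x, ~ eball y r x /\ (c0 * r ^+ n)^-1 <= cabs (K x y)) ->
  exists2 C1 : R, 0 < C1 & forall a l, 0 < l ->
    exists x0 K0 E, almost_constant K eps C1 a l x0 K0 E.
Proof.
move=> c00 eps0 nondeg; have [om0 omm _ smooth] := CZK.
pose eta := eps / ((1 + 2 ^+ n) * c0).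
have p2 : 0 < 1 + 2 ^+ n :> R by rewrite addr_gt0// exprn_gt0.
have eta0 : 0 < eta by rewrite divr_gt0// mulr_gt0.
have [t0 t00 Hom] := omega_small eta0.
(* t bounds the ratio of a displacement to the distance of the cubes; the bound
   1 / 8 keeps displaced points within reach of the smoothness estimate *)
pose t := Num.min (t0 / 2) (1 / 8).
have tp : 0 < t by rewrite lt_min; apply/andP; split; lra.
have tt0 : t < t0 by apply: (@le_lt_trans _ _ (t0 / 2)); [rewrite ge_min lexx|lra].
have t8 : t <= 1 / 8 by rewrite ge_min lexx orbT.
pose A := 2 * sn / t.
have A0 : 0 < A by rewrite divr_gt0// mulr_gt0.
have At : sn = A * t / 2 by rewrite /A mulfVK ?gt_eqF// mulrC mulKf.
exists (c0 * A ^+ n); first by rewrite mulr_gt0// exprn_gt0.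
move=> a l l0.
have [x0 [/negP x0far K0low]] := nondeg a (A * l) (mulr_gt0 A0 l0).
set K0 := K x0 a in K0low.
have Al : 0 < A * l by rewrite mulr_gt0.
have K0pos : 0 < cabs K0.
  by apply: lt_le_trans K0low; rewrite invr_gt0 mulr_gt0// exprn_gt0.
set d := enorm (x0 - a).
have dA : A * l <= d by rewrite leNgt.
have d0 : 0 < d by exact: lt_le_trans dA.
have snl : sn * l <= d * t / 2.
  rewrite At (_ : A * t / 2 * l = A * l * (t / 2)); last by ring.
  by rewrite -[d * t / 2]mulrA ler_wpM2r//; lra.
have snd : sn * l <= d / 16 by apply: le_trans snl _; nra.
have dist x : cube x0 l x -> enorm (x0 - x) <= d * t / 2.
  move=> xQ; apply: le_trans snl; apply: (@cube_diam _ _ x0) => //.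
    exact: ltW.
  by apply: cube_corner; exact: ltW.
have dist' y : cube a l y -> enorm (a - y) <= d * t / 2.
  move=> yQ; apply: le_trans snl; apply: (@cube_diam _ _ a) => //.
    exact: ltW.
  by apply: cube_corner; exact: ltW.
have dn : (d ^+ n)^-1 <= c0 * cabs K0.
  rewrite -(ler_pM2l (_ : 0 < c0^-1)) ?invr_gt0// mulKf ?gt_eqF// -invfM.
  apply: le_trans K0low; rewrite lef_pV2 ?posrE ?mulr_gt0 ?exprn_gt0//.
  by rewrite ler_wpM2l ?(ltW c00)// lerXn2r ?nnegrE// ltW.
have err x y : cube x0 l x -> cube a l y -> cabs (K x y - K0) <= eps * cabs K0.
  move=> xQ yQ; have hx := dist x xQ; have hy := dist' y yQ.
  have dt : d * t <= d / 8 by rewrite ler_wpM2l ?(ltW d0)//; lra.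
  have S1 : cabs (K x0 a - K x a) <= (d ^+ n)^-1 * eta.
    have := smooth x0 x a; rewrite -/d => S.
    apply: (@le_trans _ _ ((d ^+ n)^-1 * omega (enorm (x0 - x) / d))).
      by apply: le_trans (S _); [rewrite lerDl cabs_ge0|lra].
    rewrite ler_wpM2l ?invr_ge0 ?exprn_ge0 ?(ltW d0)//.
    apply/ltW/Hom; first by rewrite divr_ge0 ?enorm_ge0// ltW.
      by rewrite ltr_pdivrMr//; apply: le_lt_trans hx _; nra.
    by rewrite ltr_pdivrMr//; lra.
  pose D := enorm (a - x).
  have dD : d / 2 <= D.
    have := enormD (x0 - x) (x - a); rewrite addrA subrK -/d (enorm_distC x a) -/D.
    by lra.
  have D0 : 0 < D by apply: lt_le_trans dD; lra.
  have S2 : cabs (K x a - K x y) <= 2 ^+ n * (d ^+ n)^-1 * eta.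
    have := smooth a y x; rewrite -/D => S.
    apply: (@le_trans _ _ ((D ^+ n)^-1 * omega (enorm (a - y) / D))).
      by apply: le_trans (S _); [rewrite lerDr cabs_ge0|lra].
    apply: ler_pM.
    - by rewrite invr_ge0 exprn_ge0// ltW.
    - apply: om0; rewrite divr_ge0 ?enorm_ge0 ?(ltW D0)//= ltr_pdivrMr//; lra.
    - rewrite -[2 ^+ n]invrK -invfM -exprVn -exprMn lef_pV2 ?posrE ?exprn_gt0//.
        by rewrite lerXn2r ?nnegrE//; lra.
      by lra.
    - apply/ltW/Hom; first by rewrite divr_ge0 ?enorm_ge0// ltW.
        rewrite ltr_pdivrMr//; apply: le_lt_trans hy _.
        by apply: (@le_lt_trans _ _ (D * t)); nra.
      by rewrite ltr_pdivrMr//; lra.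
  have -> : K x y - K0 = (K x a - K0) - (K x a - K x y) by ring.
  apply: le_trans (cabsB _ _) _; rewrite (cabs_distC _ K0).
  apply: le_trans (lerD S1 S2) _.
  have -> : (d ^+ n)^-1 * eta + 2 ^+ n * (d ^+ n)^-1 * eta =
            (d ^+ n)^-1 * ((1 + 2 ^+ n) * eta) by ring.
  have -> : (1 + 2 ^+ n) * eta = eps / c0.
    by rewrite /eta; field; rewrite !gt_eqF.
  apply: le_trans (ler_wpM2r _ dn) _; first by rewrite divr_ge0// ltW.
  by rewrite le_eqVlt; apply/orP; left; apply/eqP; field; rewrite gt_eqF.
exists x0, K0, (fun=> eps * cabs K0).
have dis x : cube x0 l x -> ~ cube a l x.
  move=> xQ yQ; have hx := dist x xQ; have hy := dist' x yQ.
  have := enormD (x0 - x) (x - a); rewrite addrA subrK -/d (enorm_distC x a).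
  by nra.
have ek : 0 <= eps * cabs K0 by rewrite mulr_ge0 ?cabs_ge0// ltW.
have icst b : (\int[mu]_(y in cube b l) (eps * cabs K0)%:E =
    (eps * cabs K0 * l ^+ n)%:E)%E.
  apply: etrans (integral_cst mu (measurable_cube b l) (eps * cabs K0)%:E) _.
  by rewrite (EFinM _ (l ^+ n)); congr (_ * _)%E; exact: (lebesgue_cube b (ltW l0)).
split => //.
- by rewrite -cabs_eq0 gt_eqF.
- rewrite -mulrA -exprMn -[leRHS]invrK lef_pV2 ?posrE// ?invr_gt0 ?mulr_gt0 ?exprn_gt0//.
- by move=> x xQ; apply: CZ_measurable; [exact: ltW|exact: dis].
- by move=> x _; rewrite icst.
- by move=> y _; rewrite icst.
Qed.

End CZ_kernels.

(** * Homogeneous kernels *)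

Section homogeneous_kernels.
Context {R : realType} {n : nat}.
Local Notation V := 'rV[R]_n.
Local Notation mu := (@lebesgue_rV R n).
Local Notation sigma := (@surface_measure R n).
Variables (Omega : V -> R[i]) (theta : V).
Hypotheses (hn : (0 < n)%N) (mOmega : cmeasurable (@sphere R n) Omega)
  (leb : sphere_lebesgue_point Omega theta).

(** [Omega] is only measurable on the sphere. *)
Let Om (z : V) : R[i] :=
  ((((fun x => complex.Re (Omega x)) \_ sphere) z) +i*
   (((fun x => complex.Im (Omega x)) \_ sphere) z))%C.

Let OmE z : sphere z -> Om z = Omega z.
Proof. by move=> sz; rewrite /Om !patchE mem_set//; case: (Omega z). Qed.

Let measurable_Om : cmeasurable setT Om.
Proof.
by case: mOmega => m1 m2; split;
  apply/(measurable_restrictT _ _).1 => //; exact: measurable_sphere.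
Qed.

Let measurable_homogeneous : cmeasurable setT
  (fun z : V => ((enorm z ^+ n)^-1)%:C%C * Om (normalize z)).
Proof.
apply: cmeasurableM.
  apply: cmeasurable_real.
  apply: (eq_measurable_fun (fun w : V => (enorm w ^+ n) `^ (- 1))).
    by move=> x _; rewrite powR_inv1// exprn_ge0// enorm_ge0.
  apply: (measurableT_comp (measurable_powR _)).
  by apply: measurable_funX; exact: measurable_enorm.
exact: (cmeasurable_comp measurable_normalize measurable_Om).
Qed.

Let F (z : V) : R := cabs (Om z - Omega theta).

Let F0 z : 0 <= F z.
Proof. exact: cabs_ge0. Qed.

Let mF : measurable_fun setT F.
Proof. by apply: measurable_cabs; apply: cmeasurableB. Qed.

Let mFn : measurable_fun setT (fun x : V => F (normalize x)).
Proof. exact: (measurableT_comp mF measurable_normalize). Qed.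

Let cap (r : R) : set V := sphere `&` eball theta r.

Let mcap r : measurable (cap r).
Proof. by apply: measurableI; [exact: measurable_sphere|exact: measurable_eball]. Qed.

Let mNcap r : measurable (normalize @^-1` cap r).
Proof. by rewrite -[X in measurable X]setTI; apply: measurable_normalize. Qed.

Let coneE r : cone (cap r) = punctured_ball 1 `&` normalize @^-1` cap r.
Proof. by apply/seteqP; split. Qed.

Let mcone r : measurable (cone (cap r)).
Proof. by rewrite coneE; apply: measurableI => //; exact: measurable_punctured_ball. Qed.

Let cone_lty r : (mu (cone (cap r)) < +oo)%E.
Proof.
apply: (@le_lt_trans _ _ (mu (cube (0 - const_mx 1) (2 * 1)))).
  apply: le_measure; rewrite ?inE//; first exact: measurable_cube.
  move=> x [/andP[_ x1] _]; apply: ball_subset_cube; rewrite subr0; exact: ltW.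
by rewrite lebesgue_cube ?mulr1// ltry.
Qed.

(** The Lebesgue point condition on caps, read on the cones over them. *)
Let cone_integral_small (eta : R) : 0 < eta -> exists2 r0 : R, 0 < r0 &
  forall r, 0 < r -> r < r0 ->
  (\int[mu]_(x in cone (cap r)) (F (normalize x))%:E <= eta%:E * mu (cone (cap r)))%E.
Proof.
move=> eta0; case: leb => _ /fine_cvgP[[d1 /= d10 Hfin]].
move=> /cvgrPdist_lt/(_ eta eta0)[d2 /= d20 Hlt].
exists (Num.min d1 d2); first by rewrite lt_min d10.
move=> r r0; rewrite lt_min => /andP[rd1 rd2].
have rabs : `|0 - r| = r by rewrite sub0r normrN gtr0_norm.
have := Hfin r; rewrite /ball_ /= rabs => /(_ rd1 r0).
have := Hlt r; rewrite /ball_ /= rabs => /(_ rd2 r0).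
rewrite -/(cap r).
have -> : (\int[sigma]_(t in cap r) (cabs (Omega t - Omega theta))%:E =
    n%:R%:E * \int[mu]_(x in cone (cap r)) (F (normalize x))%:E)%E.
  rewrite -integral_surface_measure//; apply: eq_integral => x.
  by rewrite inE => -[sx _]; rewrite /F OmE.
have cfin : mu (cone (cap r)) \is a fin_num by rewrite ge0_fin_numE.
set c := fine (mu (cone (cap r))).
have cE : mu (cone (cap r)) = c%:E by rewrite fineK.
have c0 : 0 <= c by rewrite fine_ge0.
have n0 : 0 < n%:R :> R by rewrite ltr0n.
have -> : fine (sigma (cap r)) = n%:R * c.
  by rewrite /surface_measure/= -[LHS]/(fine (n%:R%:E * mu (cone (cap r)))%E) cE.
set I := (\int[mu]_(x in cone (cap r)) _)%E => Hl Hf.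
have I0 : (0 <= I)%E by apply: integral_ge0 => x _; rewrite lee_fin.
(* on a null cap the average in the Lebesgue point condition is 0 by convention *)
have [cz|cN0] := eqVneq c 0.
  rewrite cE cz mule0 /I null_set_integral//.
    by apply/measurable_EFinP; exact: measurable_funTS.
  by rewrite -[LHS]/(mu (cone (cap r))) cE cz.
have cp : 0 < c by rewrite lt_neqAle eq_sym cN0.
have ncp : 0 < n%:R * c by rewrite mulr_gt0.
move: Hl; rewrite sub0r normrN => /(le_lt_trans (ler_norm _)) Hl.
have : ((n%:R * c)^-1%:E * (n%:R%:E * I) <= eta%:E)%E.
  by rewrite -(fineK Hf) lee_fin ltW.
rewrite lee_pdivrMl// EFinM -muleA lee_pmul2l//.
by rewrite cE muleC.
Qed.

Let cball (del : R) : set V := [set w | enorm (w - theta) <= del].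

Let mcball del : measurable (cball del).
Proof.
rewrite (_ : cball del = (fun x => enorm (x - theta)) @^-1` `]-oo, del]%classic).
  by rewrite -[X in measurable X]setTI; apply: measurable_enorm_sub.
by apply/seteqP; split => x /=; rewrite in_itv.
Qed.

Let cball_dist del w : cball del w -> `|enorm w - 1| <= del.
Proof.
case: leb => /= t1 _ wB; have := enormD (w - theta) theta; rewrite subrK.
have := enormD (theta - w) w; rewrite subrK (enorm_distC theta).
by move: wB; rewrite /cball /= t1 ler_norml; lra.
Qed.

(** The thin annulus through the cap has the volume of a ball of comparable
radius, so that the two proportionality factors of [integral_annulus] cancel
and need not be estimated. *)
Let ball_integral_small (eta : R) : 0 < eta -> exists2 d0 : R, 0 < d0 &
  forall del, 0 < del -> del < d0 ->
  (\int[mu]_(w in cball del) (F (normalize w))%:E <= (eta * (10 * del) ^+ n)%:E)%E.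
Proof.
move=> eta0; have [r0 r00 Hr] := cone_integral_small eta0.
exists (Num.min (r0 / 3) (1 / 2)); first by rewrite lt_min; apply/andP; split; lra.
move=> del del0; rewrite lt_min => /andP[dr0 d2].
have t1 : enorm theta = 1 by case: leb.
pose B := normalize @^-1` cap (3 * del).
pose H1 : V -> R := \1_B.
pose H w := F (normalize w) * H1 w.
pose s := 1 - del; pose t := 1 + 2 * del.
have mB : measurable B by exact: mNcap.
have mH1 : measurable_fun setT H1 by exact: measurable_indic.
have mH : measurable_fun setT H by exact: measurable_funM.
have H10 x : 0 <= H1 x by rewrite /H1 indicE.
have H0 x : 0 <= H x by rewrite mulr_ge0.
have H1hom r x : 0 < r -> H1 (r *: x) = H1 x.
  move=> rp; rewrite /H1 !indicE; congr (nat_of_bool _)%:R.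
  by apply/idP/idP; rewrite !inE /B /= normalizeZ.
have Hhom r x : 0 < r -> H (r *: x) = H x.
  by move=> rp; rewrite /H H1hom// normalizeZ.
have s0 : 0 < s by rewrite /s; lra.
have st : s <= t by rewrite /s /t; lra.
have IH : (\int[mu]_(x in punctured_ball 1) (H x)%:E =
    \int[mu]_(x in cone (cap (3 * del))) (F (normalize x))%:E)%E.
  rewrite coneE integral_mkcondr; apply: eq_integral => x _.
  rewrite /H /H1 patchE indicE -/B.
  by case: (x \in B); rewrite ?mulr1 ?mulr0.
have IH1 : (\int[mu]_(x in punctured_ball 1) (H1 x)%:E = mu (cone (cap (3 * del))))%E.
  rewrite integral_indic//; last exact: measurable_punctured_ball.
  by congr (mu _); rewrite coneE setIC.
have cfin : mu (cone (cap (3 * del))) \is a fin_num by rewrite ge0_fin_numE.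
have IHle : (\int[mu]_(x in punctured_ball 1) (H x)%:E <=
    eta%:E * mu (cone (cap (3 * del))))%E.
  by rewrite IH; apply: Hr; lra.
have IHlty : (\int[mu]_(x in punctured_ball 1) (H x)%:E < +oo)%E.
  by apply: le_lt_trans IHle _; rewrite lte_mul_pinfty// ?lee_fin ltW.
have ts0 : 0 <= t ^+ n - s ^+ n.
  by rewrite subr_ge0 lerXn2r ?nnegrE// ltW//; lra.
apply: (@le_trans _ _ (\int[mu]_(x in annulus s t) (H x)%:E)%E).
  rewrite integral_mkcond [leRHS]integral_mkcond; apply: ge0_le_integral => //.
  - by move=> x _; rewrite patchE; case: ifP => //= _; rewrite lee_fin.
  - apply/(measurable_restrictT _ _).1 => //.
    by apply/measurable_EFinP; exact: measurable_funTS.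
  - apply/(measurable_restrictT _ _).1 => //; first exact: measurable_annulus.
    by apply/measurable_EFinP; exact: measurable_funTS.
  move=> x _; rewrite !patchE; case: ifPn => [|_]; last first.
    by case: ifP => _ //; rewrite lee_fin.
  rewrite inE => xB; have /[!ler_norml] xd := cball_dist xB.
  rewrite mem_set; last by rewrite /annulus /= /s /t; apply/andP; split; lra.
  have xN0 : x != 0 by rewrite -enorm_eq0 gt_eqF//; lra.
  rewrite lee_fin /H /H1 indicE mem_set ?mulr1//.
  split; first exact: enorm_normalize.
  rewrite /eball /=; have := enormB (x - theta) (x - normalize x).
  rewrite opprB addrCA (addrAC x) subrr add0r (enorm_sub_normalize xN0).
  by move: (cball_dist xB) (xB); rewrite /cball /=; lra.
rewrite integral_annulus//.
apply: (@le_trans _ _ ((t ^+ n - s ^+ n)%:E * (eta%:E * mu (cone (cap (3 * del)))))%E).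
  by rewrite lee_wpmul2l.
rewrite muleCA -IH1 -integral_annulus// ?IH1//.
rewrite EFinM lee_wpmul2l ?lee_fin ?(ltW eta0)// integral_indic//; last first.
  exact: measurable_annulus.
rewrite (_ : (10 * del) = 2 * (5 * del)); last by ring.
rewrite -(lebesgue_cube (theta - const_mx (5 * del))); last lra.
apply: le_measure; rewrite ?inE.
- by apply: measurableI => //; exact: measurable_annulus.
- exact: measurable_cube.
move=> x [[sx cx] /andP[xs xt]]; apply: ball_subset_cube.
have xN0 : x != 0.
  by rewrite -enorm_eq0 gt_eqF//; apply: lt_le_trans xs.
have := enormD (x - normalize x) (normalize x - theta); rewrite addrA subrK.
rewrite enorm_sub_normalize//; move: cx; rewrite /eball /= => cx.
have : `|enorm x - 1| <= 2 * del by rewrite ler_norml; rewrite /s /t in xs xt; lra.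
by lra.
Qed.

Let power_near1 (tau : R) : 0 < tau -> exists2 d : R, 0 < d &
  forall u, `|u - 1| < d -> `|(u ^+ n)^-1 - 1| < tau.
Proof.
move=> tau0.
have cv : (u ^+ n)^-1 @[u --> (1 : R)] --> (1 : R).
  have := @cvgV _ _ (nbhs (1 : R)) _ (fun u : R => u ^+ n) (1 ^+ n).
  rewrite expr1n invr1; apply; first exact: oner_neq0.
  by have := @exprn_continuous R n 1; rewrite /continuous_at expr1n.
have /cvgrPdist_lt/(_ tau tau0)[d /= d0 H] := cv.
by exists d => // u u1; rewrite distrC; apply: H; rewrite /ball_ /= distrC.
Qed.

(** The estimate of the kernel near the direction [theta], on the scale where the
distance between the cubes is [1]. The angular factor is close to its value at
the Lebesgue point in the mean, and the radial factor is uniformly close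
to [1]. *)
Let kernel_integral_small (eps : R) : 0 < eps -> exists del : R,
  [/\ 0 < del, del < 1 / 2 &
  (\int[mu]_(w in cball del)
    (cabs (((enorm w ^+ n)^-1)%:C%C * Om (normalize w) - Omega theta))%:E
   <= (eps * del ^+ n)%:E)%E].
Proof.
move=> eps0; set Z := cabs (Omega theta).
have Z0 : 0 <= Z by exact: cabs_ge0.
have p2 : 0 < 2 ^+ n :> R by exact: exprn_gt0.
have p10 : 0 < 10 ^+ n :> R by exact: exprn_gt0.
pose eta := eps / (2 * 2 ^+ n * 10 ^+ n).
have eta0 : 0 < eta by rewrite divr_gt0// !mulr_gt0.
pose tau := Num.min 1 (eps / (2 * 2 ^+ n * (Z + 1))).
have Z1 : 0 < Z + 1 by rewrite ltr_wpDl.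
have tau0 : 0 < tau by rewrite lt_min ltr01 divr_gt0// !mulr_gt0.
have tau1 : tau <= 1 by rewrite ge_min lexx.
have tauZ : 2 ^+ n * (tau * Z) <= eps / 2.
  have : tau <= eps / (2 * 2 ^+ n * (Z + 1)) by rewrite ge_min lexx orbT.
  rewrite ler_pdivlMr ?mulr_gt0// => H.
  rewrite ler_pdivlMr//; apply: le_trans H.
  rewrite (_ : tau * (2 * 2 ^+ n * (Z + 1)) =
    2 ^+ n * (tau * Z) * 2 + 2 * 2 ^+ n * tau); last by ring.
  by rewrite lerDl !mulr_ge0// ltW.
have [d1 d10 Hd1] := ball_integral_small eta0.
have [d2 d20 Hd2] := power_near1 tau0.
pose d := Num.min d1 (Num.min d2 (1 / 2)).
have d0 : 0 < d by rewrite !lt_min d10 d20; lra.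
have dd1 : d <= d1 by rewrite ge_min lexx.
have dd2 : d <= d2 by rewrite !ge_min lexx orbT.
have dd3 : d <= 1 / 2 by rewrite !ge_min lexx !orbT.
exists (d / 2); split; [lra|lra|].
set del := d / 2.
have del0 : 0 < del by rewrite /del; lra.
pose J w := cabs (((enorm w ^+ n)^-1)%:C%C * Om (normalize w) - Omega theta).
have mJ : measurable_fun setT J.
  apply: measurable_cabs; apply: cmeasurableB; last exact: cmeasurable_cst.
  exact: measurable_homogeneous.
apply: (@le_trans _ _ (\int[mu]_(w in cball del)
    ((2 ^+ n)%:E * (F (normalize w))%:E + (tau * Z)%:E))%E).
  apply: ge0_le_integral => //.
  - by move=> w _; rewrite lee_fin cabs_ge0.
  - by apply/measurable_EFinP; apply: measurable_funTS.
  - apply: emeasurable_funD => //; apply: measurable_funeM.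
    by apply/measurable_EFinP; exact: measurable_funTS.
  move=> w wB; rewrite -EFinM -EFinD lee_fin.
  have wd := cball_dist wB; have {}wd : `|enorm w - 1| < d2.
    by apply: le_lt_trans wd _; rewrite /del; lra.
  have := Hd2 _ wd; set u := (enorm w ^+ n)^-1 => Hu.
  have u0 : 0 <= u by rewrite invr_ge0 exprn_ge0// enorm_ge0.
  have u2 : u <= 2 ^+ n.
    have : 2 <= 2 ^+ n :> R by rewrite -[X in X <= _]expr1 ler_weXn2l// ler1n.
    move: Hu; rewrite ltr_norml; lra.
  rewrite (_ : u%:C%C * Om (normalize w) - Omega theta =
    u%:C%C * (Om (normalize w) - Omega theta) + (u - 1)%:C%C * Omega theta); last first.
    by rewrite rmorphB rmorph1; ring.
  apply: le_trans (cabsD _ _) _; rewrite !cabsM !cabs_real (ger0_norm u0).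
  by rewrite lerD// ler_wpM2r ?cabs_ge0// ltW.
rewrite ge0_integralD//; last 3 first.
- by move=> w _; rewrite -EFinM lee_fin mulr_ge0// ltW.
- by apply: measurable_funeM; apply/measurable_EFinP; exact: measurable_funTS.
- by move=> w _; rewrite lee_fin mulr_ge0// ltW.
rewrite ge0_integralZl//; last 2 first.
- by apply/measurable_EFinP; exact: measurable_funTS.
- by move=> w _; rewrite lee_fin.
have vol : (mu (cball del) <= ((2 * del) ^+ n)%:E)%E.
  rewrite -(lebesgue_cube (theta - const_mx del)); last lra.
  apply: le_measure; rewrite ?inE//; first exact: measurable_cube.
  by move=> x; exact: ball_subset_cube.
have -> : (eps * del ^+ n = 2 ^+ n * (eta * (10 * del) ^+ n) + eps / 2 * del ^+ n)%R.
  rewrite /eta [(10 * del) ^+ n]exprMn; move: p2 p10; set p := 2 ^+ n; set q := 10 ^+ n => p2 p10.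
  by field; rewrite !gt_eqF.
rewrite EFinD; apply: leeD.
  rewrite EFinM lee_wpmul2l ?lee_fin ?(ltW p2)//; apply: Hd1 => //.
  by rewrite /del; lra.
apply: (@le_trans _ _ ((tau * Z)%:E * mu (cball del))%E).
  by rewrite le_eqVlt; apply/orP; left; apply/eqP; exact: integral_cst.
apply: (@le_trans _ _ ((tau * Z)%:E * ((2 * del) ^+ n)%:E)%E).
  by rewrite lee_wpmul2l// lee_fin mulr_ge0// ltW.
rewrite -EFinM lee_fin exprMn mulrA ler_wpM2r ?exprn_ge0 ?(ltW del0)//.
by rewrite mulrC.
Qed.

(** The far cube is the translate of the given one by [d *: theta]. All
differences of points of the two cubes lie in a ball around [d *: theta] of
radius [d * del], so after a translation in either variable and a dilation by
[d] both error integrals are bounded by that of [kernel_integral_small]. *)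
Lemma homogeneous_almost_constant (K : V -> V -> R[i]) (eps : R) :
  (forall x y, x != y ->
    K x y = ((enorm (x - y) ^+ n)^-1)%:C%C * Omega (normalize (x - y))) ->
  Omega theta != 0 -> 0 < eps ->
  exists2 C1 : R, 0 < C1 & forall a l, 0 < l ->
    exists x0 K0 E, almost_constant K eps C1 a l x0 K0 E.
Proof.
move=> KE OmN0 eps0.
pose sn : R := Num.sqrt n%:R.
have sn0 : 0 < sn by rewrite sqrtr_gt0 ltr0n.
set Z := cabs (Omega theta).
have Z0 : 0 < Z by rewrite lt_neqAle cabs_ge0 eq_sym cabs_eq0 OmN0.
have t1 : enorm theta = 1 by case: leb.
have [|del [del0 del2 HJ]] := @kernel_integral_small (eps * Z / sn ^+ n).
  by rewrite divr_gt0 ?mulr_gt0 ?exprn_gt0.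
(* sn * l is the diameter of a cube, so A makes d * del equal to it *)
pose A := sn / del.
have A0 : 0 < A by rewrite divr_gt0.
exists (A ^+ n / Z); first by rewrite divr_gt0 ?exprn_gt0.
move=> a l l0.
pose d := A * l.
have d0 : 0 < d by rewrite mulr_gt0.
have dn0 : 0 < d ^+ n by rewrite exprn_gt0.
have snl : sn * l = d * del by rewrite /d /A; field; rewrite gt_eqF.
pose x0 := a + d *: theta.
pose K0 : R[i] := ((d ^+ n)^-1)%:C%C * Omega theta.
have K0abs : cabs K0 = (d ^+ n)^-1 * Z.
  by rewrite cabsM cabs_real ger0_norm// invr_ge0 ltW.
pose e (z : V) := cabs (((enorm z ^+ n)^-1)%:C%C * Om (normalize z) - K0).
have me : measurable_fun setT e.
  apply: measurable_cabs; apply: cmeasurableB; last exact: cmeasurable_cst.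
  exact: measurable_homogeneous.
have e0 z : 0 <= e z by exact: cabs_ge0.
pose P : set V := [set z | enorm (z - d *: theta) <= d * del].
have mP : measurable P.
  rewrite (_ : P = (fun x => enorm (x - d *: theta)) @^-1` `]-oo, d * del]%classic).
    by rewrite -[X in measurable X]setTI; apply: measurable_enorm_sub.
  by apply/seteqP; split => x /=; rewrite in_itv.
pose g (z : V) : \bar R := ((EFin \o e) \_ P) z.
have mg : measurable_fun setT g.
  by apply/(measurable_restrictT _ _).1 => //; apply/measurable_EFinP; exact: measurable_funTS.
have g0 z : (0 <= g z)%E by rewrite /g patchE; case: ifP => //= _; rewrite lee_fin.
have inP x y : cube x0 l x -> cube a l y -> P (x - y).
  move=> xQ yQ; rewrite /P /= -snl; apply: enorm_le_coor => [|i]; first exact: ltW.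
  have := xQ i; have := yQ i; rewrite /x0 !mxE ler_norml; lra.
have gint : (\int[mu]_z g z <= (eps * cabs K0 * l ^+ n)%:E)%E.
  have := ge0_integral_affine 0 (lt0r_neq0 d0) mg g0.
  rewrite gtr0_norm// => E1.
  have -> : (\int[mu]_z g z = (d ^+ n)%:E * \int[mu]_x g (0 + d *: x)%R)%E.
    by rewrite E1 muleA -EFinM mulfV ?gt_eqF// mul1e.
  have -> : (\int[mu]_x g (0 + d *: x)%R = (d ^+ n)^-1%:E * \int[mu]_(w in cball del)
      (cabs (((enorm w ^+ n)^-1)%:C%C * Om (normalize w) - Omega theta))%:E)%E.
    rewrite -ge0_integralZl//; first last.
    - by rewrite lee_fin invr_ge0 ltW.
    - by move=> w _; rewrite lee_fin cabs_ge0.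
    - apply/measurable_EFinP; apply: measurable_funTS.
      apply: measurable_cabs; apply: cmeasurableB; last exact: cmeasurable_cst.
      exact: measurable_homogeneous.
    rewrite [RHS]integral_mkcond; apply: eq_integral => w _; rewrite add0r /g !patchE.
    rewrite (_ : (d *: w \in P) = (w \in cball del)); last first.
      apply/idP/idP; rewrite !inE /P /cball /= -scalerBr enormZ gtr0_norm// ler_pM2l//.
    case: ifP => // _; rewrite /= -EFinM; congr EFin.
    rewrite /e normalizeZ// enormZ gtr0_norm// exprMn invfM rmorphM.
    rewrite /K0 -mulrA -mulrBr cabsM cabs_real ger0_norm// invr_ge0 ltW//.
  rewrite muleA -EFinM mulfV ?gt_eqF// mul1e; apply: le_trans HJ _.
  rewrite lee_fin K0abs /d /A le_eqVlt; apply/orP; left; apply/eqP.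
  by rewrite !exprMn exprVn; field; rewrite !gt_eqF ?exprn_gt0.
have dis x : cube x0 l x -> ~ cube a l x.
  move=> xQ yQ; have := inP x x xQ yQ.
  rewrite /P /= subrr sub0r enormN enormZ t1 gtr0_norm// ler_pM2l//; lra.
have mE : measurable_fun setT (fun z : V * V => e (z.1 - z.2)).
  apply: (measurableT_comp me); apply/measurable_fun_coorP => i.
  apply: (eq_measurable_fun (fun z : V * V => z.1 ord0 i - z.2 ord0 i)).
    by move=> z _; rewrite !mxE.
  apply: measurable_funB.
    exact: (measurableT_comp (measurable_coor i) measurable_fst).
  exact: (measurableT_comp (measurable_coor i) measurable_snd).
have neq x y : cube x0 l x -> cube a l y -> x != y.
  by move=> xQ yQ; apply/eqP => xy; apply: (dis x xQ); rewrite xy.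
have KOm x y : x != y ->
    K x y = ((enorm (x - y) ^+ n)^-1)%:C%C * Om (normalize (x - y)).
  by move=> xy; rewrite KE// OmE//; apply: enorm_normalize; rewrite subr_eq0.
have subset_int (B : set V) (f : V -> V) : measurable B ->
    measurable_fun setT (fun y => g (f y)) ->
    (forall y, B y -> P (f y)) ->
    (\int[mu]_(y in B) (e (f y))%:E <= \int[mu]_y g (f y))%E.
  move=> mB mgf BP; rewrite integral_mkcond; apply: ge0_le_integral => //.
  - by move=> x _; rewrite patchE; case: ifP => //= _; rewrite lee_fin.
  - rewrite (_ : (fun y => (e (f y))%:E) \_ B = (g \o f) \_ B).
      by apply/(measurable_restrictT _ _).1 => //; exact: measurable_funTS.
    apply/funext => y; rewrite !patchE; case: ifPn => //; rewrite inE => By.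
    by rewrite /g /= patchE mem_set//; exact: BP.
  - move=> y _; rewrite patchE; case: ifPn => [|_]; last exact: g0.
    by rewrite inE => By; rewrite /g patchE mem_set//; exact: BP.
exists x0, K0, (fun z => e (z.1 - z.2)); split => //.
- by rewrite mulf_neq0// -cabs_eq0 cabs_real normr_eq0 invr_eq0 gt_eqF.
- rewrite K0abs invfM invrK /d exprMn; rewrite le_eqVlt; apply/orP; left; apply/eqP.
  by field; rewrite gt_eqF.
- by move=> x y xQ yQ; rewrite /= KOm// neq.
- move=> x xQ.
  have mKx : cmeasurable setT
      (fun y : V => ((enorm (x - y) ^+ n)^-1)%:C%C * Om (normalize (x - y))).
    have mxy : measurable_fun setT (fun y : V => x - y).
      apply: (eq_measurable_fun (fun y : V => x + (-1) *: y)).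
        by move=> y _; rewrite scaleN1r.
      exact: measurable_affine.
    exact: (cmeasurable_comp mxy measurable_homogeneous).
  case: mKx => m1 m2; split.
    apply: (eq_measurable_fun (fun y : V => complex.Re
      (((enorm (x - y) ^+ n)^-1)%:C%C * Om (normalize (x - y))))).
      by move=> y; rewrite inE => yQ; rewrite KOm// neq.
    exact: measurable_funTS.
  apply: (eq_measurable_fun (fun y : V => complex.Im
    (((enorm (x - y) ^+ n)^-1)%:C%C * Om (normalize (x - y))))).
    by move=> y; rewrite inE => yQ; rewrite KOm// neq.
  exact: measurable_funTS.
- move=> x xQ /=.
  have E2 : (fun y => g (x - y)) = (fun y => g (x + (-1) *: y)).
    by apply/funext => y; rewrite scaleN1r.
  apply: le_trans (subset_int (cube a l) (fun y => x - y) (measurable_cube _ _) _ _) _.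
  + by rewrite E2; exact: (measurableT_comp mg (measurable_affine _ _)).
  + by move=> y yQ; exact: inP.
  rewrite E2 (ge0_integral_affine x _ mg g0) ?oppr_eq0 ?oner_eq0//.
  by rewrite normrN1 expr1n invr1 mul1e.
- move=> y yQ /=.
  have E2 : (fun x => g (x - y)) = (fun x => g (- y + 1 *: x)).
    by apply/funext => x; rewrite scale1r addrC.
  apply: le_trans (subset_int (cube x0 l) (fun x => x - y) (measurable_cube _ _) _ _) _.
  + by rewrite E2; exact: (measurableT_comp mg (measurable_affine _ _)).
  + by move=> x xQ; exact: inP.
  rewrite E2 (ge0_integral_affine (- y) _ mg g0) ?oner_eq0//.
  by rewrite normr1 expr1n invr1 mul1e.
Qed.

End homogeneous_kernels.

(** * Integrals over a set and Lebesgue norms *)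

Section restricted_complex_integral.
Context {R : realType} d (T : measurableType d) (mu : {measure set T -> \bar R})
        (D : set T) (mD : measurable D).

Lemma integral_mrestr (f : T -> \bar R) : measurable_fun setT f ->
  (\int[mrestr mu mD]_x f x = \int[mu]_(x in D) f x)%E.
Proof.
move=> mf; rewrite (integralE _ setT) (integralE mu D); congr (_ - _)%E.
  by apply: ge0_integral_mrestr => //; exact: measurable_funepos.
by apply: ge0_integral_mrestr => //; exact: measurable_funeneg.
Qed.

Lemma cintegral_mrestr_set (g : T -> R[i]) : cmeasurable setT g ->
  cintegral (mrestr mu mD) setT g = cintegral mu D g.
Proof.
move=> [m1 m2]; rewrite /cintegral /Rintegral.
by rewrite !integral_mrestr//; exact/measurable_EFinP.
Qed.

Lemma cintegral_mrestr (g : T -> R[i]) : cmeasurable setT g ->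
  cintegral (mrestr mu mD) setT g =
  cintegral mu setT (fun y => ((\1_D y : R)%:C)%C * g y).
Proof.
move=> mg; rewrite cintegral_mrestr_set// /cintegral !(Rintegral_mkcond mu D).
by congr (_ +i* _)%C; apply: eq_Rintegral => x _;
  rewrite patchE indicE; case: (x \in D); case: (g x) => u v /=;
  rewrite ?mul1r ?mul0r ?subr0 ?addr0.
Qed.

Lemma cmeasurable_indicM (g : T -> R[i]) : cmeasurable D g ->
  cmeasurable setT (fun y => ((\1_D y : R)%:C)%C * g y).
Proof.
move=> [m1 m2]; split.
  apply: (eq_measurable_fun ((fun y => complex.Re (g y)) \_ D)).
    move=> x _; rewrite patchE indicE; case: (x \in D); case: (g x) => u v /=;
    by rewrite ?mul1r ?mul0r ?subr0 ?addr0.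
  exact/(measurable_restrictT _ _).1.
apply: (eq_measurable_fun ((fun y => complex.Im (g y)) \_ D)).
  move=> x _; rewrite patchE indicE; case: (x \in D); case: (g x) => u v /=;
  by rewrite ?mul1r ?mul0r ?subr0 ?addr0.
exact/(measurable_restrictT _ _).1.
Qed.

Variables (p m : R).
Hypotheses (p1 : 1 < p) (muD : mu D = m%:E).

Let p0 : 0 < p. Proof. exact: lt_trans p1. Qed.

Let m0 : 0 <= m. Proof. by rewrite -lee_fin -muD. Qed.

Lemma cLnorm_bounded_le (f : T -> R[i]) : cmeasurable setT f ->
  (forall x, cabs (f x) <= 1) -> (forall x, ~ D x -> f x = 0) ->
  (cLnorm mu p f <= (m `^ p^-1)%:E)%E.
Proof.
move=> mf f1 fD; rewrite /cLnorm unlock -poweR_EFin.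
have le : (\int[mu]_x (`|(cabs (f x))%:E| `^ p) <= m%:E)%E.
  rewrite -muD -[leRHS]/(mu D) -(setIT D) -integral_indic//.
  apply: ge0_le_integral => //.
  - by move=> x _; exact: poweR_ge0.
  - apply: (measurableT_comp (measurable_poweR _)).
    apply: measurableT_comp => //; apply/measurable_EFinP; exact: measurable_cabs.
  - by apply/measurable_EFinP; exact: measurable_indic.
  move=> x _; have c0 : (0 <= (cabs (f x))%:E)%E by rewrite lee_fin cabs_ge0.
  rewrite (gee0_abs c0) poweR_EFin lee_fin indicE.
  have [Dx|nDx] := pselect (D x).
    have pow1 : 1 `^ p = 1 :> R by rewrite powR1.
    rewrite mem_set//= -pow1 ge0_ler_powR ?nnegrE ?cabs_ge0//; exact: ltW.
  by rewrite memNset//= fD// cabs0 powR0// gt_eqF.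
apply: gt0_ler_poweR => //; rewrite ?invr_ge0 ?(ltW p0)// in_itv /= ?andbT ?leey ?andbT.
  by apply: integral_ge0 => x _; rewrite lee_fin powR_ge0.
by rewrite lee_fin.
Qed.

Lemma integral_le_cLnorm (g : T -> R[i]) : cmeasurable setT g ->
  (\int[mu]_(x in D) (cabs (g x))%:E <= (m `^ (1 - p^-1))%:E * cLnorm mu p g)%E.
Proof.
move=> mg; pose q := (1 - p^-1)^-1.
have pV1 : p^-1 < 1 by rewrite invf_lt1.
have q0 : 0 < q by rewrite invr_gt0 subr_gt0.
have := @hoelder _ _ _ mu (fun x => cabs (g x)) \1_D p q (measurable_cabs mg)
  (measurable_indic mD) p0 q0.
rewrite /q invrK => /(_ (subrKC _ _)).
rewrite Lnorm1 muleC => H.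
have -> : (\int[mu]_(x in D) (cabs (g x))%:E =
    \int[mu]_x `|((fun x => cabs (g x)) \* \1_D) x|%:E)%E.
  rewrite integral_mkcond; apply: eq_integral => x _; rewrite patchE /= indicE.
  by case: (x \in D); rewrite ?mulr1 ?mulr0 ?normr0 ?ger0_norm ?cabs_ge0.
apply: le_trans H _; rewrite lee_wpmul2r ?Lnorm_ge0//.
rewrite unlock -poweR_EFin -{3}[1 - p^-1]invrK -/q.
have -> : (\int[mu]_x (`|(EFin \o \1_D) x| `^ q) = m%:E)%E => //.
rewrite -muD -[RHS]/(mu D) -[in RHS](setIT D) -integral_indic//.
apply: eq_integral => x _ /=; rewrite indicE.
by case: (x \in D); rewrite /= ?normr1 ?normr0 ?powR1 ?powR0// gt_eqF.
Qed.

End restricted_complex_integral.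

(** * Iterated commutators *)

Section binomial_integral.
Context {R : realType} d (T : measurableType d) (mu : {measure set T -> \bar R}).
Variables (b u : T -> R[i]) (k : nat).
Hypothesis bui : forall j, (j <= k)%N -> cintegrable mu (fun y => b y ^+ j * u y).

Let binomialE (c : R[i]) : (fun y => (c - b y) ^+ k * u y) =
  (fun y => \sum_(i < k.+1)
     (((-1) ^+ i * c ^+ (k - i)) *+ 'C(k, i)) * (b y ^+ i * u y)).
Proof.
apply/funext => y; rewrite exprBn mulr_suml; apply: eq_bigr => i _.
by rewrite !mulrnAl; congr (_ *+ _); ring.
Qed.

Lemma cintegrable_binomial (c : R[i]) :
  cintegrable mu (fun y => (c - b y) ^+ k * u y).
Proof.
rewrite binomialE; apply: cintegrable_sum => i; apply: cintegrableZ; apply: bui.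
by rewrite -ltnS.
Qed.

Lemma cintegral_binomial (c : R[i]) :
  cintegral mu setT (fun y => (c - b y) ^+ k * u y) =
  \sum_(i < k.+1) (((-1) ^+ i * c ^+ (k - i)) *+ 'C(k, i)) *
    cintegral mu setT (fun y => b y ^+ i * u y).
Proof.
have ui (i : 'I_k.+1) : cintegrable mu (fun y => b y ^+ i * u y).
  by apply: bui; rewrite -ltnS.
rewrite binomialE cintegral_sum => [|i]; last exact: cintegrableZ.
by apply: eq_bigr => i _; rewrite cintegralZ.
Qed.

End binomial_integral.

Section commutators.
Context {R : realType} {n : nat}.
Local Notation V := 'rV[R]_n.
Local Notation mu := (@lebesgue_rV R n).

Lemma supp_mul_subset (b f : V -> R[i]) : supp (fun x => b x * f x) `<=` supp f.
Proof.
by apply: closureS => x /=; apply: contra_neq => ->; rewrite mulr0.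
Qed.

(** A commutator of order [k.+1] is expressed by those of order [k] at [f] and at
[b * f], so the induction runs over all [f]. The almost everywhere exceptional
sets come from the representation of [T] at the functions [b ^+ j * f]. *)
Lemma iter_commutator_kernel (T : operator R n) (K : V -> V -> R[i])
    (b : V -> R[i]) (k : nat) (f : V -> R[i]) : associated T K ->
  odom (iter_commutator k b T) f ->
  (forall j, (j <= k)%N -> L1c (fun x => b x ^+ j * f x)) ->
  {ae mu, forall x, ~ supp f x ->
    (forall j, (j <= k)%N -> cintegrable mu (fun y => K x y * (b y ^+ j * f y))) ->
    oact (iter_commutator k b T) f x =
    cintegral mu setT (fun y => (b x - b y) ^+ k * (K x y * f y))}.
Proof.
move=> TK; elim: k f => [|k IH] f.
  move=> Df /(_ 0 isT) f1.
  have {}f1 : L1c f by move: f1; under eq_fun do rewrite expr0 mul1r.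
  have := TK f Df f1; apply: filterS => x H xf _; rewrite /= H//.
  by apply: eq_cintegral => y; rewrite expr0 mul1r.
move=> [Df Dbf] Lf.
have H1 := IH f Df (fun j jk => Lf j (leqW jk)).
have Lbf j : (j <= k)%N -> L1c (fun x => b x ^+ j * (b x * f x)).
  move=> jk; have := Lf j.+1 jk; congr L1c.
  by apply/funext => x; rewrite exprSr mulrA.
have H2 := IH _ Dbf Lbf.
apply: filterS2 H1 H2 => x H1 H2 xf Ki.
have Kbi j : (j <= k)%N -> cintegrable mu (fun y => K x y * (b y ^+ j * (b y * f y))).
  move=> jk; have := Ki j.+1 jk; congr cintegrable.
  by apply/funext => y; rewrite exprSr !mulrA.
rewrite -[LHS]/(b x * oact (iter_commutator k b T) f x -
  oact (iter_commutator k b T) (fun y => b y * f y) x).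
rewrite H1//; last by move=> j jk; apply: Ki; exact: leqW.
rewrite H2//; last by move=> /supp_mul_subset.
have Kf u : (forall j, (j <= k)%N -> cintegrable mu (fun y => K x y * (b y ^+ j * u y))) ->
    cintegrable mu (fun y => (b x - b y) ^+ k * (K x y * u y)).
  move=> ui; apply: cintegrable_binomial => j jk.
  by have := ui j jk; congr cintegrable; apply/funext => y; rewrite mulrCA.
rewrite -cintegralZ; last by apply: Kf => j jk; apply: Ki; exact: leqW.
rewrite -cintegralB; first last.
- exact: Kf.
- by apply: cintegrableZ; apply: Kf => j jk; apply: Ki; exact: leqW.
by apply: eq_cintegral => y; rewrite exprS; ring.
Qed.

End commutators.

(** * The oscillation on one cube *)

Section one_cube.
Context {R : realType} {n : nat}.
Local Notation V := 'rV[R]_n.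
Local Notation mu := (@lebesgue_rV R n).

Lemma measurable_iter_commutator (T : operator R n) (b : V -> R[i]) k f :
  linear_operator T -> cmeasurable setT b -> odom (iter_commutator k b T) f ->
  cmeasurable setT (oact (iter_commutator k b T) f).
Proof.
move=> [_ mT _] mb; elim: k f => [|k IH] f; first exact: mT.
move=> [Df Dbf]; apply: cmeasurableB; last exact: IH.
by apply: cmeasurableM => //; exact: IH.
Qed.

Lemma supp_subset_cube (f : V -> R[i]) a l :
  (forall y, ~ cube a l y -> f y = 0) -> supp f `<=` cube a l.
Proof.
move=> f0; rewrite [X in _ `<=` X](closure_id _).1; last exact: closed_cube.
apply: closureS => y /= fy; apply: contrapT => yQ.
by move: fy; rewrite f0// eqxx.
Qed.

Lemma cintegrable_mrestr (D : set V) (mD : measurable D) (g : V -> R[i]) :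
  cintegrable (mrestr mu mD) g -> cintegrable mu (fun y => ((\1_D y : R)%:C)%C * g y).
Proof.
move=> [mg gi]; split; first by apply: cmeasurable_indicM => //;
  case: mg => ? ?; split; exact: measurable_funTS.
apply: le_lt_trans gi; rewrite ge0_integral_mrestr//; last 2 first.
- by apply/measurable_EFinP; exact: measurable_cabs.
- by move=> x; rewrite lee_fin cabs_ge0.
rewrite [leRHS]integral_mkcond le_eqVlt; apply/orP; left; apply/eqP.
apply: eq_integral => x _; rewrite patchE indicE cabsM cabs_real.
by case: (x \in D); rewrite ?normr1 ?mul1r ?normr0 ?mul0r.
Qed.

Variables (T : operator R n) (K : V -> V -> R[i]) (b : V -> R[i]) (k : nat)
  (p N eps C1 : R) (a : V) (l : R) (x0 : V) (K0 : R[i]) (E : V * V -> R).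
Hypotheses (hT : linear_operator T) (TK : associated T K) (bk : Lloc k b)
  (k0 : (0 < k)%N) (p1 : 1 < p) (N0 : 0 <= N)
  (Hadm : forall f, Linftyc f -> odom (iter_commutator k b T) f /\
     (cLnorm mu p (oact (iter_commutator k b T) f) <= N%:E * cLnorm mu p f)%E)
  (l0 : 0 < l) (eps0 : 0 <= eps) (epsle : 2 ^+ (3 * k + 4) * eps <= 1)
  (ac : almost_constant K eps C1 a l x0 K0 E).

Let Q := cube a l.
Let Q' := cube x0 l.
Let m := l ^+ n.
Let mQ : measurable Q. Proof. exact: measurable_cube. Qed.
Let mQ' : measurable Q'. Proof. exact: measurable_cube. Qed.
Let muQ : mu Q = m%:E. Proof. by rewrite lebesgue_cube// ltW. Qed.
Let muQ' : mu Q' = m%:E. Proof. by rewrite lebesgue_cube// ltW. Qed.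
Let m0 : 0 < m. Proof. exact: exprn_gt0. Qed.
Let Qoo : (mu Q < +oo)%E. Proof. by rewrite muQ ltry. Qed.
Let Q'oo : (mu Q' < +oo)%E. Proof. by rewrite muQ' ltry. Qed.
Let mu1 : {finite_measure set V -> \bar R} := mfrestr mQ' Q'oo.
Let mu2 : {finite_measure set V -> \bar R} := mfrestr mQ Qoo.

Let mu1T : mu1 setT = m%:E.
Proof. by rewrite -[LHS]/(mu (setT `&` Q')) setTI. Qed.

Let mu2T : mu2 setT = m%:E.
Proof. by rewrite -[LHS]/(mu (setT `&` Q)) setTI. Qed.

Let int1 (f : V -> \bar R) : measurable_fun setT f -> (forall x, 0 <= f x)%E ->
  (\int[mu1]_x f x = \int[mu]_(x in Q') f x)%E.
Proof. exact: ge0_integral_mrestr. Qed.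

Let int2 (f : V -> \bar R) : measurable_fun setT f -> (forall x, 0 <= f x)%E ->
  (\int[mu2]_x f x = \int[mu]_(x in Q) f x)%E.
Proof. exact: ge0_integral_mrestr. Qed.

Let mb : cmeasurable setT b. Proof. by case: bk. Qed.

Let mbk : measurable_fun setT (fun x => (cabs (b x) ^+ k)%:E).
Proof. by apply/measurable_EFinP; apply: measurable_funX; exact: measurable_cabs. Qed.

Let b1k : (\int[mu1]_x (cabs (b x) ^+ k)%:E < +oo)%E.
Proof.
rewrite int1//; last by move=> x; rewrite lee_fin exprn_ge0 ?cabs_ge0.
by case: bk => _; apply; exact: compact_cube.
Qed.

Let b2k : (\int[mu2]_x (cabs (b x) ^+ k)%:E < +oo)%E.
Proof.
rewrite int2//; last by move=> x; rewrite lee_fin exprn_ge0 ?cabs_ge0.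
by case: bk => _; apply; exact: compact_cube.
Qed.

Let E' (z : V * V) : R := E z * (\1_Q' z.1 * \1_Q z.2).

Let mE' : measurable_fun setT E'.
Proof.
apply: measurable_funM; first exact: (ac_measurable_err ac).
apply: measurable_funM.
  exact: (measurable_fun_fst (measurable_indic mQ')).
exact: (measurable_fun_snd (measurable_indic mQ)).
Qed.

Let E'0 z : 0 <= E' z.
Proof. by rewrite mulr_ge0 ?(ac_err_ge0 ac)// mulr_ge0// indicE. Qed.

Let E'E x y : Q' x -> Q y -> E' (x, y) = E (x, y).
Proof. by move=> xQ yQ; rewrite /E' !indicE !mem_set//= !mulr1. Qed.

Let EK0 : 0 <= eps * cabs K0 * m.
Proof. by rewrite !mulr_ge0 ?cabs_ge0// ltW. Qed.

Let schur1 x : (\int[mu2]_y (E' (x, y))%:E <= (eps * cabs K0 * m)%:E)%E.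
Proof.
rewrite int2; last 2 first.
- by apply/measurable_EFinP; exact: measurable_section1.
- by move=> y; rewrite lee_fin.
have [xQ|xQ] := pselect (Q' x).
  apply: le_trans (ac_schur1 ac xQ); rewrite le_eqVlt; apply/orP; left; apply/eqP.
  by apply: eq_integral => y; rewrite inE => yQ; rewrite E'E.
rewrite integral0_eq ?lee_fin// => y _.
by rewrite /E' indicE /= memNset//= mul0r mulr0.
Qed.

Let schur2 y : (\int[mu1]_x (E' (x, y))%:E <= (eps * cabs K0 * m)%:E)%E.
Proof.
rewrite int1; last 2 first.
- by apply/measurable_EFinP; exact: measurable_section2.
- by move=> x; rewrite lee_fin.
have [yQ|yQ] := pselect (Q y).
  apply: le_trans (ac_schur2 ac yQ); rewrite le_eqVlt; apply/orP; left; apply/eqP.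
  by apply: eq_integral => x; rewrite inE => xQ; rewrite E'E.
rewrite integral0_eq ?lee_fin// => x _.
by rewrite /E' [\1_Q _]indicE /= memNset//= mulr0 mulr0.
Qed.

(** A common majorant of the powers [cabs (b y) ^+ j] for [j <= k]. *)
Let wt y : R := 1 + cabs (b y) ^+ k.

Let wt0 y : 0 <= wt y.
Proof. by rewrite addr_ge0// exprn_ge0// cabs_ge0. Qed.

Let mwt : measurable_fun setT wt.
Proof. by apply: measurable_funD => //; exact/measurable_EFinP. Qed.

Let wt_lty : (\int[mu2]_y (wt y)%:E < +oo)%E.
Proof.
rewrite /wt; under eq_integral do rewrite EFinD.
rewrite ge0_integralD//=; last by move=> y _; rewrite lee_fin exprn_ge0 ?cabs_ge0.
rewrite lte_add_pinfty//; have /integrableP[_] := cintegrable_cabs (cintegrable_cst mu2T 1).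
by apply: le_lt_trans; rewrite le_eqVlt; apply/orP; left; apply/eqP;
  apply: eq_integral => y _; rewrite cabs1 /= normr1.
Qed.

Let pow_le_wt j y : (j <= k)%N -> cabs (b y) ^+ j <= wt y.
Proof.
move=> jk; rewrite /wt; have [b1|/ltW b1] := leP (cabs (b y)) 1.
  by rewrite ler_wpDr ?exprn_ge0 ?cabs_ge0// exprn_ile1// cabs_ge0.
by rewrite ler_wpDl// ler_weXn2l.
Qed.

(** This makes [K x y * b y ^+ j] integrable in [y] for almost every [x], as the
kernel representation of the commutator requires. *)
Let ae_error_lty : {ae mu1, forall x, (\int[mu2]_y (E' (x, y) * wt y)%:E < +oo)%E}.
Proof.
have mEw : measurable_fun setT (fun z : V * V => E' z * wt z.2).
  by apply: measurable_funM => //; exact: measurable_fun_snd.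
have Ew0 (z : V * V) : 0 <= E' z * wt z.2 by rewrite mulr_ge0.
pose J x : \bar R := (\int[mu2]_y (E' (x, y) * wt y)%:E)%E.
have J0 x : (0 <= J x)%E by apply: integral_ge0 => y _; rewrite lee_fin mulr_ge0.
have Joo : (\int[mu1]_x J x < +oo)%E.
  rewrite -[X in (X < _)%E]/(iterint mu1 mu2 (fun z => E' z * wt z.2)) iterintC//.
  apply: (@le_lt_trans _ _ (\int[mu2]_y ((eps * cabs K0 * m)%:E * (wt y)%:E))%E).
    apply: ge0_le_integral => //.
    - by move=> y _; apply: integral_ge0 => x _; rewrite lee_fin mulr_ge0.
    - apply: (measurable_fun_fubini_tonelli_G (fun z : V * V => (E' z * wt z.2)%:E)).
        exact/measurable_EFinP.
      by move=> z; rewrite lee_fin.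
    - by apply: measurable_funeM; exact/measurable_EFinP.
    - move=> y _ /=; under eq_integral do rewrite EFinM.
      rewrite ge0_integralZr//.
      + by rewrite lee_wpmul2r// lee_fin.
      + by apply/measurable_EFinP; exact: measurable_section2.
      + by move=> x _; rewrite lee_fin.
      + by rewrite lee_fin.
  rewrite ge0_integralZl//.
  - by rewrite lte_mul_pinfty.
  - exact/measurable_EFinP.
  - by move=> y _; rewrite lee_fin.
have Ji : mu1.-integrable setT J.
  apply/integrableP; split; first exact: (measurable_inner_integral mu2 mEw).
  by under eq_integral do rewrite gee0_abs//.
have := integrable_ae measurableT Ji; apply: filterS => x /(_ I) H.
by rewrite -ge0_fin_numE//; exact: J0.
Qed.

(** The commutator is tested on the restriction of [f] to [Q]. Hoelder's
inequality bounds its integral over [Q'] by [N * m], and replacing the kernel by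
[K0] costs at most the integral against [E']. *)
Lemma commutator_test_le f : cmeasurable setT f -> (forall y, cabs (f y) <= 1) ->
  ((cabs K0)%:E * (\int[mu1]_x
     (cabs (cintegral mu2 setT (fun y => (b x - b y) ^+ k * f y)))%:E) <=
   (N * m)%:E + \int[mu1]_x \int[mu2]_y (cabs (b x - b y) ^+ k * E' (x, y))%:E)%E.
Proof.
move=> mf f1.
pose fQ y := ((\1_Q y : R)%:C)%C * f y.
have mfQ : cmeasurable setT fQ.
  by apply: cmeasurableM => //; apply: cmeasurable_real; exact: measurable_indic.
have fQ1 y : cabs (fQ y) <= 1.
  rewrite cabsM cabs_real ger0_norm ?indicE//.
  by apply: mulr_ile1; rewrite ?cabs_ge0// lern1 leq_b1.
have fQ0 y : ~ Q y -> fQ y = 0 by move=> yQ; rewrite /fQ indicE memNset//= mul0r.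
have suppQ := supp_subset_cube fQ0.
have bj_int j : (j <= k)%N -> cintegrable mu2 (fun y => b y ^+ j * f y).
  move=> jk; apply: (cintegrableM_bounded (M := 1)) => //.
  exact: (cintegrable_pow_le mu2T jk mb b2k).
have L1 j : (j <= k)%N -> L1c (fun y => b y ^+ j * fQ y).
  move=> jk; have := cintegrable_mrestr (bj_int j jk).
  rewrite (_ : (fun y => ((\1_Q y : R)%:C)%C * _) = (fun y => b y ^+ j * fQ y)).
    move=> [mi ii]; split; [exact: mi| |exact: ii].
    apply: (subclosed_compact _ (@compact_cube _ _ a l)); first exact: closed_closure.
    by move=> y /supp_mul_subset; exact: suppQ.
  by apply/funext => y; rewrite /fQ mulrCA.
have fQc : Linftyc fQ.
  split => //; last by exists 1.
  by apply: (subclosed_compact _ (@compact_cube _ _ a l)) => //; exact: closed_closure.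
have [Df Nf] := Hadm fQc.
set g := oact (iter_commutator k b T) fQ in Nf.
have mg : cmeasurable setT g by exact: measurable_iter_commutator.
have mga : measurable_fun setT (fun x => (cabs (g x))%:E).
  by apply/measurable_EFinP; exact: measurable_cabs.
have B1 : (\int[mu1]_x (cabs (g x))%:E <= (N * m)%:E)%E.
  rewrite int1//; last by move=> x; rewrite lee_fin cabs_ge0.
  apply: le_trans (integral_le_cLnorm mQ' p1 muQ' mg) _.
  have H1 := cLnorm_bounded_le mQ p1 muQ mfQ fQ1 fQ0.
  have H2 : (cLnorm mu p g <= N%:E * (m `^ p^-1)%:E)%E.
    by apply: le_trans Nf _; rewrite lee_wpmul2l.
  apply: le_trans (lee_wpmul2l _ H2) _; first by rewrite lee_fin powR_ge0.
  rewrite -!EFinM lee_fin mulrCA -powRD; last by rewrite subrK oner_eq0.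
  by rewrite subrK powRr1// ltW.
have AE1 : {ae mu1, forall x, Q' x}.
  by apply: ae_mrestr; apply/nearW => x.
have AE2 := iter_commutator_kernel TK Df L1.
have {}AE2 : {ae mu1, forall x, ~ supp fQ x ->
    (forall j, (j <= k)%N -> cintegrable mu (fun y => K x y * (b y ^+ j * fQ y))) ->
    g x = cintegral mu setT (fun y => (b x - b y) ^+ k * (K x y * fQ y))}.
  by apply: ae_mrestr; apply: filterS AE2 => x H _.
have mh : measurable_fun setT (fun z : V * V => cabs (b z.1 - b z.2) ^+ k * E' z).
  apply: measurable_funM => //; apply: measurable_funX; apply: measurable_cabs.
  by apply: cmeasurableB;
    [exact: (cmeasurable_comp measurable_fst)|exact: (cmeasurable_comp measurable_snd)].
have h0 (z : V * V) : 0 <= cabs (b z.1 - b z.2) ^+ k * E' z.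
  by rewrite mulr_ge0// exprn_ge0// cabs_ge0.
have mA : measurable_fun setT (fun x =>
    (cabs (cintegral mu2 setT (fun y => (b x - b y) ^+ k * f y)))%:E).
  apply/measurable_EFinP; apply: measurable_cabs.
  under eq_fun do rewrite (cintegral_binomial bj_int).
  apply: cmeasurable_sum => i; apply: cmeasurableM; last exact: cmeasurable_cst.
  under eq_fun do rewrite -mulrnAl; apply: cmeasurableM; first exact: cmeasurable_cst.
  exact: cmeasurableX.
rewrite -ge0_integralZl//; first last.
- by rewrite lee_fin cabs_ge0.
- by move=> x _; rewrite lee_fin cabs_ge0.
apply: (@le_trans _ _ (\int[mu1]_x ((cabs (g x))%:E +
    \int[mu2]_y (cabs (b x - b y) ^+ k * E' (x, y))%:E))%E); last first.
  rewrite ge0_integralD//.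
  - exact: leeD.
  - by move=> x _; rewrite lee_fin cabs_ge0.
  - by move=> x _; apply: integral_ge0 => y _; rewrite lee_fin (h0 (x, y)).
  - exact: (measurable_inner_integral mu2 mh).
apply: ae_ge0_le_integral => //.
- by move=> x _; rewrite -EFinM lee_fin mulr_ge0 ?cabs_ge0.
- exact: measurable_funeM.
- move=> x _; rewrite adde_ge0 ?lee_fin ?cabs_ge0//.
  by apply: integral_ge0 => y _; rewrite lee_fin (h0 (x, y)).
- apply: emeasurable_funD => //; exact: (measurable_inner_integral mu2 mh).
apply: filterS3 AE1 AE2 ae_error_lty => x xQ' gE Ew _.
(* K x is measurable on Q only *)
pose KQ y := ((\1_Q y : R)%:C)%C * K x y.
have mKQ : cmeasurable setT KQ.
  by apply: cmeasurable_indicM => //; exact: (ac_measurable ac xQ').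
have KQE y : Q y -> KQ y = K x y.
  by move=> yQ; rewrite /KQ indicE mem_set//= mul1r.
have Kbi j : (j <= k)%N -> cintegrable mu2 (fun y => b y ^+ j * (KQ y * f y)).
  move=> jk; split.
    by apply: cmeasurableM; [exact: cmeasurableX|exact: cmeasurableM].
  apply: (@le_lt_trans _ _ (\int[mu2]_y ((cabs K0 * wt y)%:E + (E' (x, y) * wt y)%:E))%E).
    have mle : measurable_fun setT (fun y => (cabs K0 * wt y)%:E + (E' (x, y) * wt y)%:E)%E.
      apply: emeasurable_funD; apply/measurable_EFinP; apply: measurable_funM => //.
      exact: measurable_section1.
    rewrite !int2//; last 3 first.
    - apply/measurable_EFinP; apply: measurable_cabs.
      by apply: cmeasurableM; [exact: cmeasurableX|exact: cmeasurableM].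
    - by move=> y; rewrite lee_fin cabs_ge0.
    - by move=> y; rewrite -EFinD lee_fin addr_ge0// mulr_ge0 ?cabs_ge0.
    apply: ge0_le_integral => //.
    - by move=> y _; rewrite lee_fin cabs_ge0.
    - apply/measurable_EFinP; apply: measurable_funTS; apply: measurable_cabs.
      by apply: cmeasurableM; [exact: cmeasurableX|exact: cmeasurableM].
    - exact: measurable_funTS.
    move=> y yQ; rewrite -EFinD lee_fin -mulrDl KQE// !cabsM mulrC cabsX.
    apply: ler_pM; rewrite ?mulr_ge0 ?exprn_ge0 ?cabs_ge0 ?pow_le_wt//.
    apply: (@le_trans _ _ (cabs (K x y))); first by rewrite ler_piMr ?cabs_ge0.
    rewrite E'E// -[K x y](subrK K0) addrC; apply: le_trans (cabsD _ _) _.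
    by rewrite lerD2l (ac_err ac).
  rewrite ge0_integralD//; last 4 first.
  - by move=> y _; rewrite lee_fin mulr_ge0 ?cabs_ge0.
  - by apply/measurable_EFinP; exact: measurable_funM.
  - by move=> y _; rewrite lee_fin mulr_ge0.
  - apply/measurable_EFinP; apply: measurable_funM => //; exact: measurable_section1.
  rewrite lte_add_pinfty//; under eq_integral do rewrite EFinM.
  rewrite ge0_integralZl//.
  - by rewrite lte_mul_pinfty ?lee_fin ?cabs_ge0.
  - exact/measurable_EFinP.
  - by move=> y _; rewrite lee_fin.
  - by rewrite lee_fin cabs_ge0.
have indQ y : ((\1_Q y : R)%:C)%C * ((\1_Q y : R)%:C)%C = ((\1_Q y : R)%:C)%C.
  by rewrite indicE; case: (y \in Q); rewrite ?mulr1 ?mulr0.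
pose G y := (b x - b y) ^+ k * (KQ y * f y).
have Gi : cintegrable mu2 G by exact: cintegrable_binomial.
have gxE : g x = cintegral mu2 setT G.
  rewrite gE.
  - rewrite [RHS]cintegral_mrestr; last by case: Gi.
    apply: eq_cintegral => y; rewrite /G /KQ /fQ.
    rewrite -[in LHS](indQ y); ring.
  - by move=> /suppQ; exact: (ac_disjoint ac xQ').
  - move=> j jk; have := cintegrable_mrestr (Kbi j jk); congr cintegrable.
    by apply/funext => y; rewrite /KQ /fQ -[in RHS](indQ y); ring.
have hfi : cintegrable mu2 (fun y => (b x - b y) ^+ k * f y).
  exact: cintegrable_binomial.
pose G2 y := G y - K0 * ((b x - b y) ^+ k * f y).
have G2i : cintegrable mu2 G2 by apply: cintegrableB => //; exact: cintegrableZ.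
have K0E : K0 * cintegral mu2 setT (fun y => (b x - b y) ^+ k * f y) =
    g x - cintegral mu2 setT G2.
  rewrite gxE cintegralB//; last exact: cintegrableZ.
  by rewrite cintegralZ// opprB addrC subrK.
rewrite -EFinM -cabsM K0E.
apply: (@le_trans _ _ ((cabs (g x))%:E + (cabs (cintegral mu2 setT G2))%:E)%E).
  by rewrite -EFinD lee_fin cabsB.
rewrite leeD2l//; apply: le_trans (le_cabs_cintegral G2i) _.
have mG2 : measurable_fun setT (fun y => (cabs (G2 y))%:E).
  by apply/measurable_EFinP; apply: measurable_cabs; case: G2i.
have mhx : measurable_fun setT (fun y => (cabs (b x - b y) ^+ k * E' (x, y))%:E).
  by apply/measurable_EFinP; exact: (measurable_section1 _ mh).
rewrite !int2//; last 2 first.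
- by move=> y; rewrite lee_fin cabs_ge0.
- by move=> y; rewrite lee_fin (h0 (x, y)).
apply: ge0_le_integral => //.
- by move=> y _; rewrite lee_fin cabs_ge0.
- exact: measurable_funTS.
- exact: measurable_funTS.
move=> y yQ; rewrite lee_fin /G2 /G KQE// E'E//.
rewrite (_ : _ - _ = (b x - b y) ^+ k * ((K x y - K0) * f y)); last by ring.
rewrite !cabsM cabsX ler_wpM2l ?exprn_ge0 ?cabs_ge0//.
apply: le_trans (ac_err ac xQ' yQ).
by rewrite ler_piMr ?cabs_ge0.
Qed.

Lemma cube_oscillation_le :
  ((m * cabs K0)%:E * (\int[mu]_(y in Q) (cabs (b y - average Q b) ^+ k)%:E) <=
   (2 ^+ (2 * k + 3) * (N * m))%:E)%E.
Proof.
have K00 : 0 < cabs K0 by rewrite lt_neqAle cabs_ge0 eq_sym cabs_eq0 (ac_neq0 ac).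
have := oscillation_le_operator_norm m0 mu1T mu2T k0 K00 eps0 epsle mb b1k mb b2k
  mE' E'0 schur1 schur2 commutator_test_le.
have -> : m^-1%:C%C * cintegral mu2 setT b = average Q b.
  rewrite /average; have -> : fine (mu Q) = m by rewrite muQ.
  by congr (_ * _); exact: cintegral_mrestr_set.
rewrite int2//.
  apply/measurable_EFinP; apply: measurable_funX; apply: measurable_cabs.
  by apply: cmeasurableB => //; exact: cmeasurable_cst.
by move=> y; rewrite lee_fin exprn_ge0// cabs_ge0.
Qed.

Lemma cube_mean_oscillation_le : exists2 t : R,
  ((fine (mu Q))^-1%:E * \int[mu]_(x in Q) (cabs (b x - average Q b))%:E)%E = t%:E &
  0 <= t /\ t ^+ k <= 2 ^+ (2 * k + 3) * C1 * N.
Proof.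
have K00 : 0 < cabs K0 by rewrite lt_neqAle cabs_ge0 eq_sym cabs_eq0 (ac_neq0 ac).
pose g y := b y - average Q b.
have gi : cintegrable mu2 g.
  apply: cintegrableB; last exact: (cintegrable_cst mu2T).
  exact: (cintegrable_pow_le mu2T (j := 1) k0 mb b2k).
have [mg _] := gi.
have ga := cintegrable_cabs gi.
have gfin := integrable_fin_num measurableT ga.
have intg : (\int[mu]_(x in Q) (cabs (g x))%:E = \int[mu2]_x (cabs (g x))%:E)%E.
  rewrite int2//; first by apply/measurable_EFinP; exact: measurable_cabs.
  by move=> y; rewrite lee_fin cabs_ge0.
exists (m^-1 * \int[mu2]_x cabs (g x)).
  have -> : fine (mu Q) = m by rewrite muQ.
  by rewrite intg EFinM; congr (_ * _)%E; rewrite /Rintegral fineK.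
split.
  by rewrite mulr_ge0 ?invr_ge0 ?(ltW m0)// Rintegral_ge0// => x _; exact: cabs_ge0.
have := power_mean_le m0 mu2T k (fun x => cabs_ge0 (g x)) ga.
rewrite int2; last 2 first.
- by apply/measurable_EFinP; apply: measurable_funX; exact: measurable_cabs.
- by move=> y; rewrite lee_fin exprn_ge0// cabs_ge0.
set t := m^-1 * _ => Ht.
have mK : 0 <= m * cabs K0 by rewrite mulr_ge0// ltW.
have : ((m * cabs K0)%:E * (m * t ^+ k)%:E <= (2 ^+ (2 * k + 3) * (N * m))%:E)%E.
  by apply: le_trans cube_oscillation_le; rewrite lee_wpmul2l.
rewrite -EFinM lee_fin => H.
have tk : t ^+ k <= 2 ^+ (2 * k + 3) * N * ((cabs K0)^-1 / m).
  rewrite -(ler_pM2l (_ : 0 < m * cabs K0 * m)) ?mulr_gt0//.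
  rewrite -[leLHS]mulrA; apply: le_trans H _; rewrite le_eqVlt; apply/orP; left; apply/eqP.
  by field; rewrite !gt_eqF.
apply: le_trans tk _; rewrite -!mulrA ler_wpM2l ?exprn_ge0// mulrC ler_wpM2r//.
by rewrite ler_pdivrMr//; exact: (ac_lower ac).
Qed.

End one_cube.

Lemma BMO_norm_pow_le {R : realType} {n : nat} (b : 'rV[R]_n -> R[i]) (k : nat) (A : R) :
  (0 < k)%N -> 0 <= A ->
  (forall a l, 0 < l -> exists2 t : R,
     ((fine (lebesgue_rV n (cube a l)))^-1%:E * \int[lebesgue_rV n]_(x in cube a l)
       (cabs (b x - average (cube a l) b))%:E)%E = t%:E & 0 <= t /\ t ^+ k <= A) ->
  (BMO_norm b ^+ k <= A%:E)%E.
Proof.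
move=> k0 A0 H.
pose r := A `^ k%:R^-1.
have r0 : 0 <= r by exact: powR_ge0.
have rk : r ^+ k = A.
  by rewrite -powR_mulrn// -powRrM mulVf ?powRr1// pnatr_eq0 -lt0n.
have le_r : (BMO_norm b <= r%:E)%E.
  apply: ge_ereal_sup => _ [_ [a [l [l0 ->]]] <-].
  have [t -> [t0 tk]] := H a l l0.
  by rewrite lee_fin -(@ler_pXn2r _ k)// ?nnegrE// rk.
have ge_0 : (0 <= BMO_norm b)%E.
  have [t tE [t0 tk]] := H 0 1 ltr01.
  apply: (@le_trans _ _ t%:E); first by rewrite lee_fin.
  rewrite -tE; apply: ereal_sup_ubound; exists (cube 0 1) => //.
  by exists 0, 1.
have fin : BMO_norm b \is a fin_num.
  by rewrite ge0_fin_numE// (le_lt_trans le_r) ?ltry.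
rewrite -(fineK fin) in le_r ge_0 *.
rewrite -EFin_expe lee_fin -rk lerXn2r ?nnegrE//.
Qed.

Theorem theorem1p2 (R : realType) (n : nat) (hn : (0 < n)%N)
    (p : R) (hp : 1 < p) (k : nat) (hk : (0 < k)%N)
    (T : operator R n) (hT : linear_operator T)
    (hK : nondegenerate_CZ_operator T \/
          nondegenerate_homogeneous_operator T) :
  exists C : R, 0 < C /\
    forall b : 'rV[R]_n -> R[i], Lloc k b ->
      (BMO_norm b ^+ k <= C%:E * op_norm p (iter_commutator k b T))%E.
Proof.
pose eps : R := (2 ^+ (3 * k + 4))^-1.
have p0 : 0 < 2 ^+ (3 * k + 4) :> R by exact: exprn_gt0.
have eps0 : 0 < eps by rewrite invr_gt0.
have epsle : 2 ^+ (3 * k + 4) * eps <= 1 by rewrite mulfV// gt_eqF.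
have [K TK [C1 C10 HK]] : exists2 K, associated T K & exists2 C1 : R, 0 < C1 &
    forall a l, 0 < l -> exists x0 K0 E, almost_constant K eps C1 a l x0 K0 E.
  case: hK => [[omega [K [CZK om0 TK [c0 [c00 nd]]]]]|].
    by exists K => //; exact: (CZ_almost_constant hn CZK om0 c00 eps0 nd).
  move=> [Om [K [[[mO _] KE] TK [t0 [leb O0]]]]].
  by exists K => //; exact: (homogeneous_almost_constant hn mO leb KE O0 eps0).
exists (2 ^+ (2 * k + 3) * C1); split; first by rewrite mulr_gt0// exprn_gt0.
move=> b bk.
have C0 : 0 < 2 ^+ (2 * k + 3) * C1 by rewrite mulr_gt0// exprn_gt0.
rewrite -lee_pdivrMl//; apply: le_ereal_inf_tmp => _ [N [N0 Hadm] <-].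
rewrite lee_pdivrMl// -EFinM.
apply: BMO_norm_pow_le => //; first by rewrite mulr_ge0// ltW.
move=> a l l0; have [x0 [K0 [E ac]]] := HK a l l0.
exact: (cube_mean_oscillation_le hT TK bk hk hp N0 Hadm l0 (ltW eps0) epsle ac).
Qed.
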